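(* There exists an absolute constant $A>0$ such that for every $D>0$, every $(2,D)$-smooth separable Banach space $(\mathcal X,\|\cdot\|)$, every $f\in\mathcal M(\mathcal X)$, every $p\ge2$ and every $c$ with $1\le c\le p$, $$\|f^*\|_p\le A\left(c\|d^*\|_p+\sqrt c\,e^{p/c}D\|s_2\|_p\right);$$ in particular, $$\|f^*\|_p\le A\left(p\|d^*\|_p+\sqrt p\,D\|s_2\|_p\right),$$ $$\|f^*\|_p\le A\,\frac p{\ln p}\left(\|d^*\|_p+D\|s_2\|_p\right),$$ $$\|f^*\|_p\le A\left(\alpha\|d^*\|_p+e^{p/\alpha}D\|s_2\|_p\right)\qquad\text{for all }\alpha\text{ with } 1\le\alpha\le\frac p{\ln(ep)}.$$
   Context: A real Banach space $(\mathcal X,\|\cdot\|)$ is called $(2,D)$-smooth if $\|x+y\|^2+\|x-y\|^2\le 2\|x\|^2+2D^2\|y\|^2$ for all $x,y\in\mathcal X$. For a separable Banach space $\mathcal X$, $\mathcal M(\mathcal X)$ is the class of all martingales $f=(f_0,f_1,\ldots)$ of Bochner-integrable random vectors in $\mathcal X$ with $f_0\equiv 0$, defined on some probability space with respect to some filtration $(F_0,F_1,\ldots)$ (both may depend on $f$). Put $d_0=0$, $d_j=f_j-f_{j-1}$ for $j\ge1$, $f^*=\sup_{j\ge0}\|f_j\|$, $d^*=\sup_{j\ge0}\|d_j\|$, $s_2=\left(\sum_{j=1}^\infty\mathbf E_{j-1}\|d_j\|^2\right)^{1/2}$, where $\mathbf E_{j-1}$ is the conditional expectation given $F_{j-1}$.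 For a real random variable $Y$, $\|Y\|_p=(\mathbf E|Y|^p)^{1/p}\in[0,\infty]$. *)

(* Defs.v *)
From HB Require Import structures.
From mathcomp Require Import all_boot all_order all_algebra.
From mathcomp Require Import all_classical all_reals all_analysis.
From mathcomp Require Import measurable_realfun.
Set Implicit Arguments.
Unset Strict Implicit.
Unset Printing Implicit Defensive.
Import Order.TTheory GRing.Theory Num.Theory.
Import numFieldNormedType.Exports.
Local Open Scope classical_set_scope.
Local Open Scope ring_scope.

Definition smooth2 (R : realType) (X : normedModType R) (D : R) : Prop :=
  forall x y : X,
    `|x + y| ^+ 2 + `|x - y| ^+ 2 <= 2 * `|x| ^+ 2 + 2 * D ^+ 2 * `|y| ^+ 2.

Definition separable (X : topologicalType) : Prop :=
  exists S : set X, countable S /\ dense S.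

Definition measurable_wrt (T Y : Type) (G : set (set T)) (B : set (set Y))
    (f : T -> Y) : Prop :=
  forall U, B U -> G (f @^-1` U).

Definition borel_sets (X : topologicalType) : set (set X) :=
  <<s [set U : set X | open U] >>.

Section bochner.
Context (d : measure_display) (T : measurableType d) (R : realType).
Context (X : normedModType R).
Variable P : probability T R.

Definition simple (s : T -> X) : Prop :=
  finite_set (range s) /\ forall v, measurable (s @^-1` [set v]).

Definition simple_integral (E : set T) (s : T -> X) : X :=
  \sum_(v \in range s) fine (P (E `&` s @^-1` [set v])) *: v.

Definition L1_approx (E : set T) (s : nat -> T -> X) (f : T -> X) : Prop :=
  (forall n, simple (s n)) /\
  (fun n => \int[P]_(x in E) (`|f x - s n x|)%:E)%E @ \oo --> 0%E.

(* On a separable space, Borel measurability is strong measurability. *)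
Definition bochner_integrable (f : T -> X) : Prop :=
  measurable_wrt measurable (@borel_sets X) f /\
  exists s, L1_approx setT s f.

(* [v] is the Bochner integral over [E] of the integrable function [f]; it does
   not depend on the approximating sequence. *)
Definition is_bochner_integral (E : set T) (f : T -> X) (v : X) : Prop :=
  exists s, L1_approx E s f /\ simple_integral E (s n) @[n --> \oo] --> v.

(* [g] is a version of the conditional expectation of [f] given [G]. *)
Definition is_bochner_condexp (G : set (set T)) (f g : T -> X) : Prop :=
  [/\ measurable_wrt G (@borel_sets X) g,
      bochner_integrable g &
      forall E, G E ->
        exists v, is_bochner_integral E f v /\ is_bochner_integral E g v].

End bochner.

(* Conditional expectation of a nonnegative, not necessarily integrable, random
   variable; both sides of the averaging identity may be [+oo]. *)
Definition is_condexp_ge0 (d : measure_display) (T : measurableType d)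
    (R : realType) (P : probability T R) (G : set (set T))
    (Y Z : T -> \bar R) : Prop :=
  [/\ forall x, (0 <= Z x)%E,
      measurable_wrt G measurable Z &
      forall E, G E -> (\int[P]_(x in E) Z x = \int[P]_(x in E) Y x)%E].

Definition filtration (d : measure_display) (T : measurableType d)
    (F : nat -> set (set T)) : Prop :=
  [/\ forall j, sigma_algebra setT (F j),
      forall j, F j `<=` measurable &
      forall j, F j `<=` F j.+1].

(* The class of martingales started at 0, with respect to [F]; the last clause
   includes the adaptedness of [f]. *)
Definition martingale0 (d : measure_display) (T : measurableType d)
    (R : realType) (X : normedModType R) (P : probability T R)
    (F : nat -> set (set T)) (f : nat -> T -> X) : Prop :=
  [/\ filtration F,
      forall x, f 0%N x = 0,
      forall j, bochner_integrable P (f j) &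
      forall j, is_bochner_condexp P (F j) (f j.+1) (f j)].

Section functionals.
Context (R : realType) (X : normedModType R) (T : Type).

Definition mdiff (f : nat -> T -> X) (j : nat) (x : T) : X :=
  if j is i.+1 then f i.+1 x - f i x else 0.

Definition maxnorm (f : nat -> T -> X) (x : T) : \bar R :=
  ereal_sup (range (fun j => (`|f j x|)%:E)).

(* [V j], for [1 <= j], stands for the conditional expectation of the squared
   norm of the [j]-th difference; [V 0] is not used. *)
Definition square_function (V : nat -> T -> \bar R) (x : T) : \bar R :=
  sqrte (\sum_(1 <= j <oo) V j x)%E.

End functionals.

Definition predictable_squares (d : measure_display) (T : measurableType d)
    (R : realType) (X : normedModType R) (P : probability T R)
    (F : nat -> set (set T)) (f : nat -> T -> X) (V : nat -> T -> \bar R)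
    : Prop :=
  forall j, (1 <= j)%N ->
    is_condexp_ge0 P (F j.-1) (fun x => (`|mdiff f j x| ^+ 2)%:E) (V j).

(* Main.v *)
Require Import Defs.
From HB Require Import structures.
From mathcomp Require Import all_boot all_order all_algebra finmap.
From mathcomp Require Import all_classical all_reals all_analysis.
From mathcomp Require Import measurable_realfun.
From mathcomp Require Import ring lra.

(** The proof is a good-lambda argument. Write [f* ], [d* ] and [s_2] for the maximal
    function, the maximal increment and the conditional square function. At every
    level [lam > 0],

      P(f* > 4 lam, d* <= a, D s_2 <= b) <= exp(- 3 p) P(f* > lam)

    with [a = lam / (7 c)] and [b = lam / (7 sqrt(c) exp(p / c))]
    ([good_lambda], [level_exponent]). As [exp(- 3 p) <= 8^(- p)] is small
    compared with [4^(- p)], integrating over the levels ([tail_comparison]) and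
    absorbing the moment of [f* ] gives

      ||f* ||_p <= 56 (c ||d* ||_p + sqrt(c) exp(p / c) D ||s_2||_p)

    ([norm_process_Lnorm_le]); the other three bounds are choices of [c]
    ([choice_log], [choice_power]).

    The estimate at one level comes from an exponential supermartingale. The energy
    is [exp(th q(f_j))] with [th = 7 p / lam] and [q(v) = sqrt(lam^2 + |v|^2)].
    Instead of linearising the norm at [f_(j-1)], the two points
    [f_(j-1) + d_j] and [f_(j-1) - d_j] are compared: smoothness bounds the sum of
    their energies ([small_jump_growth]), while the martingale property makes the
    average of [|f_(j-1) - d_j|] at least [|f_(j-1)|] ([reflected_norm_ge]), so the
    energy of the reflected point is on average not below that of [f_(j-1)], and
    the energy of [f_j] grows by a factor at most [1 + growth * V_j]. Increments
    larger than [a] are not truncated but simply stop being counted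
    ([large_jump_growth]), so no martingale with bounded increments has to be
    constructed.

    Only the norms of [f_j], [d_j] and [f_(j-1) - d_j] occur in these estimates;
    [norm_process] collects the relations between them. They use [1 <= D], and a
    [(2, D)]-smooth space with [D < 1] is zero ([smooth2_trivial]). *)

Set Implicit Arguments.
Unset Strict Implicit.
Unset Printing Implicit Defensive.
Import Order.TTheory GRing.Theory Num.Theory.
Import numFieldNormedType.Exports.
Local Open Scope classical_set_scope.
Local Open Scope ring_scope.

(** * Measurability and averages over a sub-sigma-algebra *)

(** Putting [G] in the type lets the measurability lemmas for functions on a
    measurable space be applied to [G]-measurable functions unchanged. *)
Definition measurable_for (T : pointedType) (G : set (set T))
    d' (Y : measurableType d') (f : T -> Y) : Prop :=
  @measurable_fun _ _ (g_sigma_algebraType G) Y setT f.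

Lemma measurable_for_sub d (T : measurableType d) (G : set (set T))
    d' (Y : measurableType d') (f : T -> Y) :
  sigma_algebra setT G -> G `<=` measurable ->
  measurable_for G f -> measurable_fun setT f.
Proof.
move=> sG Gm mf _ B mB; apply: Gm.
by have := mf measurableT B mB; rewrite /measurable/= sigma_algebra_id.
Qed.

Lemma measurable_forP (T : pointedType) (G : set (set T))
    d' (Y : measurableType d') (f : T -> Y) :
  sigma_algebra setT G ->
  (forall B, measurable B -> G (f @^-1` B)) <-> measurable_for G f.
Proof.
move=> sG; split=> [h _ B mB|mf B mB].
  by rewrite setTI /measurable/= sigma_algebra_id//; exact: h.
by have := mf measurableT B mB; rewrite setTI /measurable/= sigma_algebra_id.
Qed.

Section weighted.
Context d (T : measurableType d) (R : realType) (mu : {measure set T -> \bar R}).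
Variable G : set (set T).
Hypotheses (sG : sigma_algebra setT G) (Gm : G `<=` measurable).
Variables (Y : T -> R) (Z : T -> \bar R).
Hypotheses (mY : measurable_fun setT Y) (mZ : measurable_fun setT Z).
Hypotheses (Y0 : forall x, 0 <= Y x) (Z0 : forall x, (0 <= Z x)%E).
Hypothesis YZ : forall E, G E ->
  (\int[mu]_(x in E) (Y x)%:E <= \int[mu]_(x in E) Z x)%E.
Import HBNNSimple.

Local Open Scope ereal_scope.

Let simple_weight (W : T -> \bar R) (mW : measurable_fun setT W)
   (W0 : forall x, 0 <= W x) (h : {nnsfun (g_sigma_algebraType G) >-> R}) :
  \int[mu]_x ((h x)%:E * W x) =
  \sum_(r \in range h) (r%:E * \int[mu]_(x in h @^-1` [set r]) W x).
Proof.
have Gh r : measurable (h @^-1` [set r] : set T).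
  by apply: Gm; have := measurable_funPTI h (measurable_set1 r);
  rewrite /measurable/= sigma_algebra_id.
have r0 r : range h r -> (0 <= r)%R by move=> [x _ <-].
transitivity (\int[mu]_x \sum_(r \in range h)
   (`|r|%:E * (W x * (\1_(h @^-1` [set r]) x)%:E))).
  apply: eq_integral => x _.
  rewrite [in LHS](fimfunE h x) -fsumEFin//.
  rewrite ge0_mule_fsuml; last first.
    move=> r; rewrite lee_fin/=.
    have [rh|/preimage10->] := pselect (range h r).
      by rewrite mulr_ge0// r0.
    by rewrite indic0 mulr0.
  apply: eq_fsbigr => r /set_mem rh.
  by rewrite ger0_norm ?r0// EFinM -muleA; congr (_ * _); rewrite muleC.
rewrite ge0_integral_fsum//; last 2 first.
- move=> r; apply: measurable_funeM; apply: emeasurable_funM => //.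
  by apply/measurable_EFinP; exact: measurable_indic.
- by move=> r x _; rewrite mule_ge0// mule_ge0.
apply: eq_fsbigr => r /set_mem rh.
rewrite ge0_integralZl//; last 2 first.
- apply: emeasurable_funM => //.
  by apply/measurable_EFinP; exact: measurable_indic.
- by move=> x _; rewrite mule_ge0.
by rewrite ger0_norm ?r0// [in RHS]integral_mkcond epatch_indic.
Qed.

(** The comparison of averages over the sets of [G] passes to nonnegative
    [G]-measurable weights, by approximating the weight by simple functions.
    Conditional averages enter the energy estimate only in this form. *)
Lemma weighted_integral_le (h : T -> R) :
  (forall x, 0 <= h x)%R -> measurable_for G h ->
  \int[mu]_x ((h x)%:E * (Y x)%:E) <= \int[mu]_x ((h x)%:E * Z x).
Proof.
move=> h0 mh.
have mh' : @measurable_fun _ _ (g_sigma_algebraType G) _ setT (EFin \o h).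
  by apply/measurable_EFinP.
pose a := nnsfun_approx measurableT mh'.
have ma n : measurable_fun setT (a n : T -> R).
  apply: (measurable_for_sub sG Gm); exact: measurable_funP.
have mY' : measurable_fun setT (EFin \o Y) by exact/measurable_EFinP.
have lim : \int[mu]_x ((a n x)%:E * (Y x)%:E) @[n --> \oo] -->
    \int[mu]_x ((h x)%:E * (Y x)%:E).
  have -> : \int[mu]_x ((h x)%:E * (Y x)%:E) =
      \int[mu]_x (limn (fun n => (a n x)%:E * (Y x)%:E)).
    apply: eq_integral => x _; apply/esym/cvg_lim => //.
    apply: cvgeZr => //.
    apply: (cvg_nnsfun_approx measurableT mh') => // y _.
    by rewrite /= lee_fin.
  apply: cvg_monotone_convergence => //.
  - by move=> n; apply: emeasurable_funM => //; exact/measurable_EFinP.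
  - by move=> n x _; rewrite mule_ge0// lee_fin.
  - move=> x _ m n mn; apply: lee_wpmul2r; rewrite ?lee_fin//.
    by move/lefP: (nd_nnsfun_approx measurableT mh' mn); apply.
apply: (cvge_to_le lim); apply: nearW => n.
apply: (@le_trans _ _ (\int[mu]_x ((a n x)%:E * Z x))).
  rewrite simple_weight; [|exact: mY'|by move=> x; rewrite lee_fin].
  rewrite simple_weight//.
  apply: lee_fsum => // r [x _ <-].
  apply: lee_wpmul2l; first by rewrite lee_fin.
  apply: YZ; have := measurable_funPTI (a n) (measurable_set1 (a n x)).
  by rewrite /measurable/= sigma_algebra_id.
apply: ge0_le_integral => //.
- by move=> x _; rewrite mule_ge0// lee_fin.
- by apply: emeasurable_funM => //; exact/measurable_EFinP.
- apply: emeasurable_funM => //; apply/measurable_EFinP.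
  exact: (measurable_for_sub sG Gm).
move=> x _; apply: lee_wpmul2r => //.
rewrite /a nnsfun_approxE.
apply: (le_approx (D := setT) (f := EFin \o h)) => // y _.
by rewrite /= lee_fin.
Qed.

End weighted.

(** * One step of the energy

    The energy of a vector of norm [x] is [expR (th * smoothed lam x)]. *)

Section one_step.
Context (R : realType).
Implicit Types z x y : R.

(** From [expR z - 1 <= z * expR z], used once to bound [expR z - 1 - z] by
    [z * (expR z - 1)] and once more on that product. *)
Lemma expR_le_taylor1 z : expR z <= 1 + z + z ^+ 2 * expR `|z|.
Proof.
have zE : expR z - 1 <= z * expR z.
  have := expR_ge1Dx (- z); rewrite expRN => h.
  have ez : 0 < expR z := expR_gt0 z.
  have : (1 - z) * expR z <= 1 by rewrite -ler_pdivlMr// div1r.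
  lra.
have [z0|z0] := leP 0 z.
  rewrite ger0_norm//; have : z * (expR z - 1) <= z * (z * expR z).
    exact: ler_wpM2l.
  by rewrite expr2; lra.
rewrite ltr0_norm//.
have h1 : 1 <= expR (- z) by rewrite -expR0 ler_expR; lra.
have h2 := expR_ge1Dx z.
have : z ^+ 2 * 1 <= z ^+ 2 * expR (- z) by apply: ler_wpM2l; rewrite // sqr_ge0.
have : z * z <= z * (z * expR z) + z * (z - z * expR z) by rewrite -mulrDr; lra.
have : - z * (1 - expR z) <= - z * - z by apply: ler_wpM2l; lra.
by rewrite expr2; lra.
Qed.

Let sqrtK (c : R) : 0 <= c -> Num.sqrt (c ^+ 2) = c.
Proof. by move=> c0; rewrite sqrtr_sqr ger0_norm. Qed.

(** The norm of the direct sum with a line, at height [lam]. It inherits the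
    smoothness inequality and stays above [lam], so that differences of squares
    can be divided by it. *)
Definition smoothed (lam x : R) : R := Num.sqrt (lam ^+ 2 + x ^+ 2).

Variable lam : R.
Hypothesis lam0 : 0 < lam.

Lemma sqr_smoothed x : smoothed lam x ^+ 2 = lam ^+ 2 + x ^+ 2.
Proof. by rewrite sqr_sqrtr// addr_ge0// sqr_ge0. Qed.

Lemma smoothed_ge x : lam <= smoothed lam x.
Proof.
have lamE := sqrtK (ltW lam0).
by rewrite -[leLHS]lamE; apply: ler_wsqrtr; rewrite lerDl sqr_ge0.
Qed.

Lemma ge_smoothed x : 0 <= x -> x <= smoothed lam x.
Proof.
move=> /sqrtK xE.
by rewrite -[leLHS]xE; apply: ler_wsqrtr; rewrite lerDr sqr_ge0.
Qed.

Lemma smoothed_le x c : 0 <= c -> lam ^+ 2 + x ^+ 2 <= c ^+ 2 -> smoothed lam x <= c.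
Proof.
by move=> /sqrtK cE h; rewrite -[leRHS]cE; apply: ler_wsqrtr.
Qed.

Lemma smoothed_lipschitz x y n : 0 <= x -> 0 <= y -> `|y - x| <= n ->
  smoothed lam y - smoothed lam x <= n.
Proof.
move=> x0 y0 h; have n0 : 0 <= n by rewrite (le_trans _ h).
have u0 := ge_smoothed x0; have u1 := smoothed_ge x.
rewrite lerBlDr; apply: smoothed_le; first by lra.
rewrite sqrrD sqr_smoothed.
have : x * n <= smoothed lam x * n by apply: ler_wpM2r.
have : y ^+ 2 <= (x + n) ^+ 2.
  rewrite ler_sqr ?nnegrE//; last lra.
  by move: h; rewrite ler_norml; lra.
rewrite sqrrD; lra.
Qed.

(** Convexity in [x], written with the slope of the tangent; it amounts to the
    Cauchy-Schwarz inequality for [(lam, x)] and [(lam, z)]. *)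
Lemma smoothed_tangent x z : 0 <= x -> 0 <= z ->
  smoothed lam x + x / smoothed lam x * (z - x) <= smoothed lam z.
Proof.
move=> x0 z0.
have u0 : 0 < smoothed lam x := lt_le_trans lam0 (smoothed_ge x).
have -> : smoothed lam x + x / smoothed lam x * (z - x) =
    (lam ^+ 2 + x * z) / smoothed lam x.
  apply: (mulIf (lt0r_neq0 u0)); rewrite divfK ?lt0r_neq0//.
  rewrite mulrDl -expr2 sqr_smoothed mulrAC divfK ?lt0r_neq0//; ring.
rewrite ler_pdivrMr// -ler_sqr ?nnegrE; last 2 first.
- by rewrite addr_ge0// ?sqr_ge0// mulr_ge0.
- by rewrite mulr_ge0// ltW// (lt_le_trans lam0 (smoothed_ge _)).
rewrite exprMn !sqr_smoothed -subr_ge0.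
have -> : (lam ^+ 2 + z ^+ 2) * (lam ^+ 2 + x ^+ 2) - (lam ^+ 2 + x * z) ^+ 2
  = (lam * (x - z)) ^+ 2 by ring.
exact: sqr_ge0.
Qed.

Variables th a D : R.
Hypotheses (th0 : 0 < th) (a0 : 0 < a).

(** Three costs per unit of squared increment: discarding increments larger
    than [a], the smoothness inequality, and the second order term of the
    exponential. *)
Definition growth : R :=
  th / a + th * D ^+ 2 / lam + 2 * th ^+ 2 * D ^+ 2 * expR (th * a).

Lemma growth_ge : th / a <= growth.
Proof.
rewrite -subr_ge0 (_ : growth - th / a = th * D ^+ 2 / lam +
  2 * th ^+ 2 * D ^+ 2 * expR (th * a)); last by rewrite /growth; ring.
apply: addr_ge0; last first.
  apply: mulr_ge0; last exact: expR_ge0.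
  by apply: mulr_ge0; [apply: mulr_ge0; rewrite ?sqr_ge0|exact: sqr_ge0].
by rewrite divr_ge0 ?(ltW lam0)// mulr_ge0 ?sqr_ge0// ltW.
Qed.

Lemma growth_ge0 : 0 <= growth.
Proof. by apply: le_trans growth_ge; rewrite divr_ge0// ltW. Qed.

Variables x n y z : R.
Hypotheses (x0 : 0 <= x) (y0 : 0 <= y) (z0 : 0 <= z).
Hypotheses (yx : `|y - x| <= n) (zx : `|z - x| <= n) (nDn : n <= D * n).
Hypothesis yz : y ^+ 2 + z ^+ 2 <= 2 * x ^+ 2 + 2 * D ^+ 2 * n ^+ 2.

Let u := smoothed lam x.
Let n0 : 0 <= n. Proof. exact: le_trans yx. Qed.
Let u0 : 0 < u. Proof. exact: lt_le_trans lam0 (smoothed_ge x). Qed.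

(** Here [x], [n], [y], [z] are the norms of [f_(j-1)], [d_j], [f_(j-1) + d_j]
    and [f_(j-1) - d_j]. Smoothness bounds the sum of the energies of the last
    two, and convexity bounds the energy of the reflected one from below by its
    tangent. The tangent is kept on the left with [z] untouched: after averaging,
    [z] dominates [x] and the two slope terms cancel. *)
Lemma small_jump_growth : n <= a ->
  expR (th * smoothed lam y) + th * (x / u) * expR (th * u) * z <=
  expR (th * u) * (1 + th * (x / u) * x + growth * n ^+ 2).
Proof.
move=> na.
have n2D : n ^+ 2 <= D ^+ 2 * n ^+ 2.
  by rewrite -exprMn ler_sqr ?nnegrE// (le_trans n0).
set s := smoothed lam y; set t := smoothed lam z.
have sE : s = u + (s - u) by ring.
have su : `|s - u| <= n.
  rewrite ler_norml; apply/andP; split; last exact: smoothed_lipschitz.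
  by rewrite lerNl opprB smoothed_lipschitz// distrC.
have tu : `|t - u| <= n.
  rewrite ler_norml; apply/andP; split; last exact: smoothed_lipschitz.
  by rewrite lerNl opprB smoothed_lipschitz// distrC.
(* Each of [s], [t] satisfies [s - u <= (s^2 - u^2) / (2 u)], and [u >= lam]. *)
have st : s + t - 2 * u <= D ^+ 2 * n ^+ 2 / lam.
  rewrite ler_pdivlMr//.
  have [h|h] := leP (s + t - 2 * u) 0.
    apply: (@le_trans _ _ 0); first by rewrite mulr_le0_ge0// ltW.
    by rewrite mulr_ge0 ?sqr_ge0.
  apply: (@le_trans _ _ ((s + t - 2 * u) * u)).
    by apply: ler_wpM2l; [exact: ltW | exact: smoothed_ge].
  have := sqr_ge0 (s - u); have := sqr_ge0 (t - u).
  move: yz; have := sqr_smoothed x; have := sqr_smoothed y; have := sqr_smoothed z.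
  rewrite -/s -/t -/u; nra.
have ts : t - u >= x / u * (z - x) by rewrite lerBrDl; exact: smoothed_tangent.
have taylor w : `|w| <= n ->
    expR (th * w) <= 1 + th * w + th ^+ 2 * n ^+ 2 * expR (th * a).
  move=> wn; apply: (le_trans (expR_le_taylor1 _)); rewrite lerD2l.
  rewrite normrM (gtr0_norm th0) exprMn; apply: ler_pM => //.
  - by rewrite -exprMn sqr_ge0.
  - apply: ler_wpM2l; first exact: sqr_ge0.
    by rewrite -real_normK ?num_real// ler_sqr ?nnegrE.
  - by rewrite ler_expR ler_pM2l// (le_trans wn).
have Es := taylor _ su; have Et := taylor _ tu.
have Et1 := expR_ge1Dx (th * (t - u)).
rewrite [X in expR (th * X) + _]sE mulrDr expRD.
have -> : th * (x / u) * expR (th * u) * z =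
    expR (th * u) * (th * (x / u) * z) by ring.
rewrite -mulrDr; apply: ler_wpM2l; first exact: expR_ge0.
have h1 : th * (x / u * (z - x)) <= th * (t - u) by rewrite ler_pM2l.
have h2 : th * (s + t - 2 * u) <= th * (D ^+ 2 * n ^+ 2 / lam).
  by rewrite ler_pM2l.
have h3 : th ^+ 2 * expR (th * a) * n ^+ 2 <=
    th ^+ 2 * expR (th * a) * (D ^+ 2 * n ^+ 2).
  by apply: ler_wpM2l => //; rewrite mulr_ge0 ?sqr_ge0 ?expR_ge0.
have h4 : 0 <= th / a * n ^+ 2.
  by rewrite mulr_ge0 ?sqr_ge0// divr_ge0// ltW.
have -> : growth * n ^+ 2 = th / a * n ^+ 2 + th * (D ^+ 2 * n ^+ 2 / lam) +
  2 * (th ^+ 2 * expR (th * a) * (D ^+ 2 * n ^+ 2)) by rewrite /growth; ring.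
lra.
Qed.

(** An increment larger than [a] contributes no energy on the left, but it may
    lower [z] by [n]; this is paid for by [n <= n ^+ 2 / a]. *)
Lemma large_jump_growth : a < n ->
  th * (x / u) * expR (th * u) * z <=
  expR (th * u) * (1 + th * (x / u) * x + growth * n ^+ 2).
Proof.
move=> an.
have -> : th * (x / u) * expR (th * u) * z =
    expR (th * u) * (th * (x / u) * z) by ring.
apply: ler_wpM2l; first exact: expR_ge0.
have xu0 : 0 <= x / u by rewrite divr_ge0// ltW.
have xu1 : x / u <= 1 by rewrite ler_pdivrMr// mul1r ge_smoothed.
have xun : x / u * (z - x) <= n.
  apply: (@le_trans _ _ ((x / u) * n)); last exact: ler_piMl.
  by apply: ler_wpM2l => //; move: zx; rewrite ler_norml => /andP[].
have na : n <= n ^+ 2 / a by rewrite ler_pdivlMr// expr2 ler_wpM2l// ltW.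
have : th * (x / u * (z - x)) <= th * (n ^+ 2 / a).
  by rewrite ler_pM2l// (le_trans xun).
have h : 0 <= (growth - th / a) * n ^+ 2.
  by rewrite mulr_ge0 ?sqr_ge0// subr_ge0 growth_ge.
lra.
Qed.

End one_step.

(** * Adapted processes and the level-crossing estimate *)

Section bool_rv.
Context d (T : measurableType d) (R : realType).
Implicit Types f : T -> bool.

Lemma measurable_natr_bool f :
  measurable_fun setT f -> measurable_fun setT (fun t => (f t)%:R : R).
Proof.
move=> mf; rewrite (_ : (fun t => _) = (fun t => if f t then 1 else 0)).
  exact: measurable_fun_ifT.
by apply/funext => t; case: (f t).
Qed.

Lemma measurable_boolset f : measurable_fun setT f -> measurable [set t | f t].
Proof.
move=> mf; rewrite (_ : [set t | f t] = f @^-1` [set true]).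
  by rewrite -[X in measurable X]setTI; apply: mf.
by apply/seteqP; split=> t /=; case: (f t).
Qed.

Lemma integral_natr_bool (mu : {measure set T -> \bar R}) f :
  measurable_fun setT f ->
  (\int[mu]_t ((f t)%:R)%:E = mu [set t | f t])%E.
Proof.
move=> /measurable_boolset mf; rewrite -[X in mu X]setIT -integral_indic//.
apply: eq_integral => t _; rewrite indicE; congr ((nat_of_bool _)%:R)%:E.
by apply/idP/idP; rewrite inE.
Qed.

End bool_rv.

Section adapted.
Context d (T : measurableType d) (R : realType).
Variable F : nat -> set (set T).
Hypothesis filtF : filtration F.

Lemma filtration_le i j : (i <= j)%N -> F i `<=` F j.
Proof.
case: filtF => _ _ Fle; elim: j => [|j IH]; first by rewrite leqn0 => /eqP->.
by rewrite leq_eqVlt ltnS => /predU1P[->//|/IH/subset_trans]; apply.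
Qed.

Lemma adapted_le i j d' (Y : measurableType d') (f : T -> Y) : (i <= j)%N ->
  measurable_for (F i) f -> measurable_for (F j) f.
Proof.
case: (filtF) => sF _ _ ij /(measurable_forP _ (sF i)) mf.
by apply/(measurable_forP _ (sF j)) => B mB; exact/(filtration_le ij)/mf.
Qed.

Lemma adapted_measurable i d' (Y : measurableType d') (f : T -> Y) :
  measurable_for (F i) f -> measurable_fun setT f.
Proof. by case: filtF => sF Fm _; exact: measurable_for_sub. Qed.

Fixpoint runmax (g : nat -> T -> R) (n : nat) (t : T) : R :=
  if n is k.+1 then Num.max (runmax g k t) (g n t) else g 0%N t.

Lemma runmax_ge g k t : g k t <= runmax g k t.
Proof. by case: k => [|k] //=; rewrite le_max lexx orbT. Qed.

Lemma runmax_adapted g n :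
  (forall j, measurable_for (F j) (g j)) -> measurable_for (F n) (runmax g n).
Proof.
move=> mg; elim: n => [|n IH]; first exact: mg.
have IH1 := adapted_le (leqnSn n) IH.
apply: measurable_maxr; [exact: IH1|exact: mg].
Qed.

End adapted.

(** The scalar trace of a martingale: [x j], [n j] and [z j.+1] stand for the
    norms of [f_j], [d_j] and [f_j - d_(j+1)]. The last two fields are all that
    remains of the martingale property and of the predictable squares; everything
    up to the moment bound is derived from these scalar relations. *)
Record norm_process d (T : measurableType d) (R : realType)
    (P : probability T R) (F : nat -> set (set T)) (D : R)
    (x n z : nat -> T -> R) (V : nat -> T -> \bar R) : Prop := NormProcess {
  np_filtration : filtration F;
  np_init : forall t, x 0%N t = 0;
  np_x_ge0 : forall j t, 0 <= x j t;
  np_z_ge0 : forall j t, 0 <= z j t;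
  np_V_ge0 : forall j t, (0 <= V j.+1 t)%E;
  np_x_step : forall j t, `|x j.+1 t - x j t| <= n j.+1 t;
  np_z_step : forall j t, `|z j.+1 t - x j t| <= n j.+1 t;
  np_smooth : forall j t, x j.+1 t ^+ 2 + z j.+1 t ^+ 2 <=
    2 * x j t ^+ 2 + 2 * D ^+ 2 * n j.+1 t ^+ 2;
  np_x_adapted : forall j, measurable_for (F j) (x j);
  np_n_adapted : forall j, measurable_for (F j) (n j);
  np_V_predictable : forall j, measurable_for (F j) (V j.+1);
  np_z_measurable : forall j, measurable_fun setT (z j.+1);
  np_x_le_z : forall j E, F j E ->
    (\int[P]_(t in E) (x j t)%:E <= \int[P]_(t in E) (z j.+1 t)%:E)%E;
  np_n_le_V : forall j E, F j E ->
    (\int[P]_(t in E) (n j.+1 t ^+ 2)%:E <= \int[P]_(t in E) V j.+1 t)%E }.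

Section good_lambda.
Context d (T : measurableType d) (R : realType) (P : probability T R).
Variables (F : nat -> set (set T)) (D : R) (x n z : nat -> T -> R).
Variable V : nat -> T -> \bar R.
Hypothesis xnzV : norm_process P F D x n z V.
Hypothesis D1 : 1 <= D.

Let filtF := np_filtration xnzV.
Let x_0 := np_init xnzV.
Let x_ge0 := np_x_ge0 xnzV.
Let z_ge0 := np_z_ge0 xnzV.
Let V_ge0 := np_V_ge0 xnzV.
Let x_step := np_x_step xnzV.
Let z_step := np_z_step xnzV.
Let xz_smooth := np_smooth xnzV.
Let x_adapted j : measurable_for (F j) (x j) :=
  @np_x_adapted _ _ _ _ _ _ _ _ _ _ xnzV j.
Let n_adapted j : measurable_for (F j) (n j) :=
  @np_n_adapted _ _ _ _ _ _ _ _ _ _ xnzV j.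
Let V_predictable j : measurable_for (F j) (V j.+1) :=
  @np_V_predictable _ _ _ _ _ _ _ _ _ _ xnzV j.
Let z_measurable j : measurable_fun setT (z j.+1) :=
  @np_z_measurable _ _ _ _ _ _ _ _ _ _ xnzV j.
Let x_le_z := np_x_le_z xnzV.
Let n_le_V := np_n_le_V xnzV.

(* The second order term of the exponential comes without a factor [D]; this
   bounds it by [D ^+ 2] times the squared increment. *)
Let n_D j t : n j.+1 t <= D * n j.+1 t.
Proof. by rewrite ler_peMl// (le_trans _ (x_step j t)). Qed.

Definition sumV (j : nat) (t : T) : \bar R := (\sum_(1 <= i < j.+1) V i t)%E.

Lemma sumVS j t : sumV j.+1 t = (sumV j t + V j.+1 t)%E.
Proof. by rewrite /sumV big_nat_recr. Qed.

Lemma sumV_ge0 j t : (0 <= sumV j t)%E.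
Proof. by rewrite /sumV big_nat; apply: sume_ge0 => -[|i]. Qed.

Lemma sumV_predictable j : measurable_for (F j) (sumV j.+1).
Proof.
elim: j => [|j IH].
  rewrite (_ : sumV 1 = V 1%N); first exact: V_predictable.
  by apply/funext => t; rewrite /sumV big_nat1.
rewrite (_ : sumV j.+2 = (fun t => sumV j.+1 t + V j.+2 t)%E); last first.
  by apply/funext => t; rewrite sumVS.
have IH1 := adapted_le filtF (leqnSn j) IH.
by apply: emeasurable_funD; [exact: IH1|exact: V_predictable].
Qed.

Lemma sumV_measurable j : measurable_fun setT (sumV j).
Proof.
case: j => [|j]; last exact: (adapted_measurable filtF (@sumV_predictable j)).
rewrite (_ : sumV 0 = cst 0%E); first exact: measurable_cst.
by apply/funext => t; rewrite /sumV big_geq.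
Qed.

Variables lam a b th : R.
Hypotheses (lam0 : 0 < lam) (a0 : 0 < a) (a_lam : a <= lam) (th0 : 0 < th).

Let Gam := growth lam th a D.
Let M := runmax x.
Let N := runmax n.
Let started j t := lam < M j t.
(* [alive] constrains [sumV j.+1], which is known at time [j]: the path is
   dropped just before the bound [b] would be exceeded. *)
Let alive j t :=
  [&& M j t <= 4 * lam, lam < M j t, N j t <= a & (sumV j.+1 t <= b%:E)%E].
Let crossed j t := [&& 4 * lam < M j t, N j t <= a & (sumV j t <= b%:E)%E].
Let u j t := smoothed lam (x j t).
(* Discounting by the accumulated predictable squares makes the energy a
   supermartingale while the path is alive. *)
Let disc j t := expR (- Gam * fine (sumV j t)).

Let E (f : T -> R) : \bar R := (\int[P]_t (f t)%:E)%E.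

Let alive_adapted j : measurable_for (F j) (alive j).
Proof.
have mM := @runmax_adapted _ _ _ F filtF x j x_adapted.
have mN := @runmax_adapted _ _ _ F filtF n j n_adapted.
apply: measurable_and; first exact: measurable_fun_ler.
apply: measurable_and; first exact: measurable_fun_ltr.
apply: measurable_and; first exact: measurable_fun_ler.
by apply: measurable_fun_lee => //; exact: (@sumV_predictable j).
Qed.

Let measurable_smoothed : measurable_fun setT (smoothed lam).
Proof.
apply: measurableT_comp; last first.
  by apply: measurable_funD => //; exact: measurable_funX.
by apply: continuous_measurable_fun; exact: sqrt_continuous.
Qed.

Let slope (y : R) := th * (y / smoothed lam y) * expR (th * smoothed lam y).

Let measurable_energy : measurable_fun setT (fun y => expR (th * smoothed lam y)).
Proof. by apply: measurableT_comp => //; exact: measurable_funM. Qed.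

Let measurable_slope : measurable_fun setT slope.
Proof.
apply: measurable_funM => //; apply: measurable_funM => //.
apply: measurable_funM => //; apply: continuous_measurable_fun => y.
apply: continuousV; first exact: (lt0r_neq0 (lt_le_trans lam0 (smoothed_ge lam0 y))).
rewrite /smoothed; apply: continuous_comp; last exact: sqrt_continuous.
by apply: cvgD; [exact: cvg_cst|exact: exprn_continuous].
Qed.

Let slope_ge0 y : 0 <= y -> 0 <= slope y.
Proof.
move=> y0; rewrite mulr_ge0 ?expR_ge0// mulr_ge0 ?(ltW th0)// divr_ge0//.
exact: sqrtr_ge0.
Qed.

Let E_le (f g : T -> R) : (forall t, 0 <= f t <= g t) ->
  measurable_fun setT f -> measurable_fun setT g -> (E f <= E g)%E.
Proof.
move=> fg mf mg; apply: ge0_le_integral => //; try exact/measurable_EFinP.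
- by move=> t _; rewrite lee_fin; case/andP: (fg t).
- by move=> t _; rewrite lee_fin; case/andP: (fg t).
Qed.

Let E_D (f g : T -> R) : (forall t, 0 <= f t) -> (forall t, 0 <= g t) ->
  measurable_fun setT f -> measurable_fun setT g ->
  (E (fun t => f t + g t)%R = E f + E g)%E.
Proof.
move=> f0 g0 mf mg; rewrite /E -ge0_integralD//; try exact/measurable_EFinP.
- by move=> t _; rewrite lee_fin.
- by move=> t _; rewrite lee_fin.
Qed.

Let E_ge0 (f : T -> R) : (forall t, 0 <= f t) -> (0 <= E f)%E.
Proof. by move=> f0; apply: integral_ge0 => t _; rewrite lee_fin. Qed.

Let disc_predictable j : measurable_for (F j) (disc j.+1).
Proof.
apply: measurableT_comp => //; apply: measurable_funM => //.
apply: measurableT_comp (@sumV_predictable j); exact: fine_measurable.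
Qed.

Let C1 := expR (th * (4 * lam)) * expR (- Gam * b).
Let C2 := expR (th * (3 * lam)).
Let psi j t := expR (th * u j t) * disc j t.

Let Gam0 : 0 <= Gam := growth_ge0 lam0 D th0 a0.

Let disc_le1 j t : disc j t <= 1.
Proof.
by rewrite -expR0 ler_expR mulNr oppr_le0 mulr_ge0 ?fine_ge0 ?sumV_ge0.
Qed.

Let x_measurable j : measurable_fun setT (x j) :=
  adapted_measurable filtF (@x_adapted j).
Let n_measurable j : measurable_fun setT (n j) :=
  adapted_measurable filtF (@n_adapted j).

Let alive_measurable j : measurable_fun setT (alive j) :=
  adapted_measurable filtF (@alive_adapted j).

Let started_measurable j : measurable_fun setT (started j).
Proof.
apply: measurable_fun_ltr => //.
exact: (adapted_measurable filtF (@runmax_adapted _ _ _ F filtF x j x_adapted)).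
Qed.

Let crossed_measurable j : measurable_fun setT (crossed j).
Proof.
have mM := adapted_measurable filtF (@runmax_adapted _ _ _ F filtF x j x_adapted).
have mN := adapted_measurable filtF (@runmax_adapted _ _ _ F filtF n j n_adapted).
apply: measurable_and; first exact: measurable_fun_ltr.
apply: measurable_and; first exact: measurable_fun_ler.
by apply: measurable_fun_lee => //; exact: sumV_measurable.
Qed.

Let psi_measurable j : measurable_fun setT (psi j).
Proof.
apply: measurable_funM; first exact: (measurableT_comp measurable_energy).
apply: measurableT_comp => //; apply: measurable_funM => //.
by apply: measurableT_comp (sumV_measurable j); exact: fine_measurable.
Qed.

(* On the survivors with increment at most [a], the discounted energy does not
   grow on average. The weights [hs] and [he] are known at time [j], so the slope
   terms in [z] and [x] compare by [x_le_z] and cancel, the latter being finite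
   because [x j <= 4 * lam] on [alive]. *)
Let drift_step j :
  (E (fun t => (alive j t && (n j.+1 t <= a))%:R * psi j.+1 t)%R <=
   E (fun t => (alive j t)%:R * psi j t)%R)%E.
Proof.
case: (filtF) => sF Fm _.
pose h t := (alive j t)%:R * disc j.+1 t.
have h_adapted : measurable_for (F j) h.
  apply: measurable_funM; first exact: (measurable_natr_bool (@alive_adapted j)).
  exact: (@disc_predictable j).
pose hs t := h t * slope (x j t).
pose he t := h t * expR (th * u j t).
have hs_adapted : measurable_for (F j) hs.
  by apply: measurable_funM => //; exact: measurableT_comp (@x_adapted j).
have he_adapted : measurable_for (F j) he.
  apply: measurable_funM => //.
  exact: (measurableT_comp measurable_energy (@x_adapted j)).
have mV : measurable_fun setT (V j.+1).
  exact: (adapted_measurable filtF (@V_predictable j)).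
have mh := adapted_measurable filtF h_adapted.
have mhs := adapted_measurable filtF hs_adapted.
have mhe := adapted_measurable filtF he_adapted.
have h_ge0 t : 0 <= h t by rewrite mulr_ge0 ?expR_ge0.
have hs_ge0 t : 0 <= hs t by rewrite mulr_ge0 ?slope_ge0.
have he_ge0 t : 0 <= he t by rewrite mulr_ge0 ?expR_ge0.
pose jump t := (alive j t && (n j.+1 t <= a))%:R * psi j.+1 t.
have jump_ge0 t : 0 <= jump t by rewrite mulr_ge0 ?mulr_ge0 ?expR_ge0.
have mjump : measurable_fun setT jump.
  apply: measurable_funM => //; apply: measurable_natr_bool.
  by apply: measurable_and => //; exact: measurable_fun_ler.
have pointwise t : jump t + hs t * z j.+1 t <=
    he t + hs t * x j t + Gam * he t * n j.+1 t ^+ 2.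
  rewrite /jump /psi /hs /he /h; case: (boolP (alive j t)) => [_|_]; last first.
    by rewrite /= !(mul0r, mulr0, addr0).
  rewrite !mul1r/= -/(u j t).
  have d0 : 0 <= disc j.+1 t := expR_ge0 _.
  have [na|an] := leP (n j.+1 t) a.
    have := small_jump_growth lam0 th0 a0 (x_ge0 j t) (x_ge0 j.+1 t)
      (z_ge0 j.+1 t) (x_step j t) (z_step j t) (n_D j t) (xz_smooth j t) na.
    move=> /(ler_wpM2l d0); rewrite -/Gam /slope /u mul1r; lra.
  have := large_jump_growth lam0 D th0 a0 (x_ge0 j t)
    (x_step j t) (z_step j t) an.
  move=> /(ler_wpM2l d0); rewrite -/Gam /slope /u mul0r; lra.
have hsz : (E (fun t => hs t * x j t)%R <= E (fun t => hs t * z j.+1 t)%R)%E.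
  apply: (@weighted_integral_le _ _ _ P _ (sF j) (Fm j) (x j)
    (EFin \o z j.+1)) => //; first exact/measurable_EFinP.
  - by move=> t; rewrite lee_fin.
  - exact: (@x_le_z j).
have hsx_fin : E (fun t => hs t * x j t)%R \is a fin_num.
  rewrite ge0_fin_numE; last by apply: E_ge0 => t; rewrite mulr_ge0.
  pose c := th * expR (th * (5 * lam)) * (4 * lam).
  have c0 : 0 <= c by rewrite !mulr_ge0 ?expR_ge0// ltW.
  apply: (@le_lt_trans _ _ (E (cst c))); last first.
    rewrite /E (integral_cst P measurableT c%:E) -[ltLHS]/(c%:E * P setT)%E.
    by rewrite probability_setT mule1 ltry.
  apply: E_le => //; last exact: measurable_funM.
  move=> t; rewrite mulr_ge0//= /hs /h.
  case: (boolP (alive j t)) => [/and4P[xlam _ _ _]|_]; last by rewrite !mul0r.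
  have {}xlam : x j t <= 4 * lam := le_trans (runmax_ge x j t) xlam.
  have s1 : slope (x j t) <= th * expR (th * (5 * lam)).
    rewrite /slope -mulrA ler_pM2l//.
    have s0 := lt_le_trans lam0 (smoothed_ge lam0 (x j t)).
    rewrite -[leRHS]mul1r; apply: ler_pM; rewrite ?expR_ge0//.
    + by rewrite divr_ge0// ltW.
    + by rewrite ler_pdivrMr// mul1r ge_smoothed.
    rewrite ler_expR ler_pM2l//; apply: smoothed_le; first by rewrite mulr_ge0// ltW.
    have := x_ge0 j t; nra.
  rewrite mul1r; apply: ler_pM => //; first by rewrite mulr_ge0 ?expR_ge0 ?slope_ge0.
  by rewrite -[leRHS]mul1r; apply: ler_pM; rewrite ?expR_ge0 ?slope_ge0.
have heV : (E (fun t => Gam * he t * n j.+1 t ^+ 2)%R <=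
    \int[P]_t ((Gam * he t)%:E * V j.+1 t))%E.
  apply: (@weighted_integral_le _ _ _ P _ (sF j) (Fm j)
    (fun t => n j.+1 t ^+ 2) (V j.+1) _ mV _ (V_ge0 j) (@n_le_V j)
    (fun t => Gam * he t)).
  - exact: measurable_funX.
  - by move=> t; exact: sqr_ge0.
  - by move=> t; rewrite mulr_ge0.
  - exact: measurable_funM.
have cancel : (E jump <= E he + \int[P]_t ((Gam * he t)%:E * V j.+1 t))%E.
  rewrite -(leeD2rE _ _ hsx_fin).
  apply: (@le_trans _ _ (E jump + E (fun t => hs t * z j.+1 t)%R)%E).
    exact: leeD2l.
  apply: (@le_trans _ _ (E he + E (fun t => hs t * x j t)%R +
      E (fun t => Gam * he t * n j.+1 t ^+ 2)%R)%E); last first.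
    by rewrite addeAC; apply: leeD2r; apply: leeD2l.
  have mn2 : measurable_fun setT (fun t => n j.+1 t ^+ 2).
    exact: measurable_funX.
  have mhe' : measurable_fun setT (fun t => Gam * he t) by exact: measurable_funM.
  have mhsx : measurable_fun setT (fun t => hs t * x j t).
    exact: measurable_funM.
  have mhsz : measurable_fun setT (fun t => hs t * z j.+1 t).
    exact: measurable_funM.
  have mhen : measurable_fun setT (fun t => Gam * he t * n j.+1 t ^+ 2).
    exact: measurable_funM.
  have hsx0 t : 0 <= hs t * x j t by rewrite mulr_ge0.
  have hsz0 t : 0 <= hs t * z j.+1 t by rewrite mulr_ge0.
  have hen0 t : 0 <= Gam * he t * n j.+1 t ^+ 2.
    by apply: mulr_ge0; rewrite ?sqr_ge0// mulr_ge0.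
  rewrite -E_D// -(E_D he_ge0)// -E_D//; last 2 first.
  - by move=> t; rewrite addr_ge0.
  - exact: measurable_funD.
  apply: E_le => [t||]; last 2 first.
  - exact: measurable_funD.
  - by apply: measurable_funD => //; exact: measurable_funD.
  by rewrite pointwise andbT addr_ge0.
apply: (le_trans cancel).
rewrite -ge0_integralD//; last 4 first.
- by move=> t _; rewrite lee_fin.
- exact/measurable_EFinP.
- by move=> t _; rewrite mule_ge0// lee_fin mulr_ge0.
- by apply: emeasurable_funM => //; apply/measurable_EFinP; exact: measurable_funM.
apply: ge0_le_integral => //.
- by move=> t _; rewrite adde_ge0 ?mule_ge0 ?lee_fin// mulr_ge0.
- apply: emeasurable_funD; first exact/measurable_EFinP.
  by apply: emeasurable_funM => //; apply/measurable_EFinP; exact: measurable_funM.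
- apply/measurable_EFinP; apply: measurable_funM; last exact: psi_measurable.
  exact: measurable_natr_bool.
move=> t _; rewrite /he /h.
case: (boolP (alive j t)) => [/and4P[_ _ _ Wb]|_]; last first.
  by rewrite !(mul0r, mulr0) mul0e adde0.
have : sumV j.+1 t \is a fin_num.
  by rewrite ge0_fin_numE ?sumV_ge0// (le_lt_trans Wb)// ltry.
rewrite /psi /disc sumVS !mul1r fin_numD => /andP[].
move: (sumV j t) (V j.+1 t) => [w||] [v||]// _ _.
rewrite -EFinM -EFinD lee_fin /= mulrDr expRD.
have v1 : (1 + Gam * v) * expR (- Gam * v) <= 1.
  have := expR_ge1Dx (Gam * v); rewrite mulNr expRN ler_pdivrMr ?expR_gt0//.
  by rewrite mul1r.
have c0 : 0 <= expR (th * u j t) * expR (- Gam * w) by rewrite mulr_ge0 ?expR_ge0.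
have := ler_wpM2l c0 v1; lra.
Qed.

Let disc_ge j t : (sumV j t <= b%:E)%E -> expR (- Gam * b) <= disc j t.
Proof.
move=> Wb; have Wfin : sumV j t \is a fin_num.
  by rewrite ge0_fin_numE ?sumV_ge0// (le_lt_trans Wb)// ltry.
rewrite ler_expR !mulNr lerN2 ler_wpM2l//.
by rewrite -lee_fin fineK.
Qed.

(* Bookkeeping for one step. A path that crosses [4 * lam] for the first time was
   alive one step before and carries energy at least [C1]. A path that newly
   exceeds [lam] does so by an increment at most [a <= lam], so it starts with
   energy at most [C2], as [lam ^+ 2 + (2 * lam) ^+ 2 <= (3 * lam) ^+ 2]. *)
Let transition j t :
  C1 * (crossed j.+1 t)%:R + (alive j.+1 t)%:R * psi j.+1 t + C2 * (started j t)%:R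
  <= C1 * (crossed j t)%:R + (alive j t && (n j.+1 t <= a))%:R * psi j.+1 t
     + C2 * (started j.+1 t)%:R.
Proof.
have C10 : 0 <= C1 by rewrite mulr_ge0 ?expR_ge0.
have C20 : 0 <= C2 by rewrite expR_ge0.
have psi0 i : 0 <= psi i t by rewrite mulr_ge0 ?expR_ge0.
have u_psi : 0 <= (alive j t && (n j.+1 t <= a))%:R * psi j.+1 t.
  by rewrite mulr_ge0.
have WW : (sumV j t <= sumV j.+1 t)%E by rewrite sumVS leeDl.
have WW' : (sumV j.+1 t <= sumV j.+2 t)%E by rewrite [leRHS]sumVS leeDl.
have xM := runmax_ge x j t; rewrite -/M in xM.
have jump_le : x j.+1 t <= x j t + n j.+1 t.
  by have := x_step j t; rewrite ler_norml; lra.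
have M' : M j.+1 t = Num.max (M j t) (x j.+1 t) by [].
have N' : N j.+1 t = Num.max (N j t) (n j.+1 t) by [].
have st_mono : C2 * (started j t)%:R <= C2 * (started j.+1 t)%:R.
  apply: ler_wpM2l => //; rewrite ler_nat /started M'.
  by case: ltP => // h; rewrite lt_max h.
case: (boolP (crossed j.+1 t)) => [/and3P[bM bN bW]|_].
  have -> : alive j.+1 t = false by rewrite /alive leNgt bM.
  rewrite mul0r addr0; move: bN; rewrite N' ge_max => /andP[bN bn].
  have [Mj|Mj] := ltP (4 * lam) (M j t).
    by rewrite /crossed Mj bN (le_trans WW bW)/= !mulr1; lra.
  move: bM; rewrite M' lt_max ltNge Mj/= => xj.
  have sj : lam < M j t.
    apply: (lt_le_trans _ xM); move: xj jump_le bn a_lam lam0.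
    move: (x j.+1 t) (x j t) (n j.+1 t) => x1 x2 n1; lra.
  have -> : alive j t by rewrite /alive Mj sj bN bW.
  rewrite bn /= mul1r.
  have : C1 <= psi j.+1 t.
    apply: ler_pM; rewrite ?expR_ge0 ?disc_ge//.
    by rewrite ler_expR ler_pM2l// (le_trans (ltW xj))// ge_smoothed.
  have : 0 <= C1 * (crossed j t)%:R by rewrite mulr_ge0.
  by rewrite mulr1; lra.
rewrite mulr0 add0r.
have bad0 : 0 <= C1 * (crossed j t)%:R by rewrite mulr_ge0.
case: (boolP (alive j.+1 t)) => [|_]; last by rewrite mul0r; lra.
move=> /and4P[]; rewrite M' N' ge_max => /andP[Mj xj] sj.
rewrite ge_max => /andP[Nj nj] Wj; rewrite mul1r.
have [lM|Ml] := ltP lam (M j t).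
  have -> : alive j t by rewrite /alive Mj lM Nj (le_trans WW' Wj).
  by rewrite nj mul1r; lra.
have -> : started j.+1 t by rewrite /started M'.
have -> : started j t = false by rewrite /started ltNge Ml.
have : psi j.+1 t <= C2.
  rewrite -[leRHS]mulr1; apply: ler_pM; rewrite ?expR_ge0//.
  rewrite ler_expR ler_pM2l//; apply: smoothed_le; first by rewrite mulr_ge0// ltW.
  have : x j.+1 t <= 2 * lam.
    move: (le_trans xM Ml) jump_le nj a_lam.
    move: (x j.+1 t) (x j t) (n j.+1 t) => x1 x2 n1; lra.
  move: (x_ge0 j.+1 t) lam0; move: (x j.+1 t) => x1; nra.
rewrite /= mulr1 mulr0 addr0; lra.
Qed.

Let stop_potential j t := C1 * (crossed j t)%:R + (alive j t)%:R * psi j t.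

Let E_stop_potential k :
  (E (stop_potential k) <= E (fun t => C2 * (started k t)%:R)%R)%E.
Proof.
have C10 : 0 <= C1 by rewrite mulr_ge0 ?expR_ge0.
have C20 : 0 <= C2 by rewrite expR_ge0.
have psi0 i t : 0 <= psi i t by rewrite mulr_ge0 ?expR_ge0.
have mbad j : measurable_fun setT (fun t => C1 * (crossed j t)%:R).
  by apply: measurable_funM => //; exact: measurable_natr_bool.
have malive j : measurable_fun setT (fun t => (alive j t)%:R * psi j t).
  by apply: measurable_funM => //; exact: measurable_natr_bool.
have mstart j : measurable_fun setT (fun t => C2 * (started j t)%:R).
  by apply: measurable_funM => //; exact: measurable_natr_bool.
have mU j : measurable_fun setT
    (fun t => (alive j t && (n j.+1 t <= a))%:R * psi j.+1 t).
  apply: measurable_funM => //; apply: measurable_natr_bool.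
  by apply: measurable_and => //; exact: measurable_fun_ler.
have bad0 j t : 0 <= C1 * (crossed j t)%:R by rewrite mulr_ge0.
have alive0 j t : 0 <= (alive j t)%:R * psi j t by rewrite mulr_ge0.
have start0 j t : 0 <= C2 * (started j t)%:R by rewrite mulr_ge0.
have U0 j t : 0 <= (alive j t && (n j.+1 t <= a))%:R * psi j.+1 t.
  by rewrite mulr_ge0.
have mstop j : measurable_fun setT (stop_potential j) by exact: measurable_funD.
have stop0 j t : 0 <= stop_potential j t by rewrite addr_ge0.
elim: k => [|k IH].
  apply: E_le => // t; rewrite stop0/=.
  have M0 : M 0%N t = 0 by exact: x_0.
  have crossed_0 : crossed 0%N t = false by rewrite /crossed M0 ltNge mulr_ge0// ltW.
  have alive_0 : alive 0%N t = false.
    by rewrite /alive M0 [lam < 0]ltNge (ltW lam0) andbF.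
  by rewrite /stop_potential crossed_0 alive_0 mulr0 mul0r addr0.
have fin : E (fun t => C2 * (started k t)%:R) \is a fin_num.
  rewrite ge0_fin_numE; last exact: E_ge0.
  apply: (@le_lt_trans _ _ (E (cst C2))); last first.
    rewrite /E (integral_cst P measurableT C2%:E) -[ltLHS]/(C2%:E * P setT)%E.
    by rewrite probability_setT mule1 ltry.
  apply: E_le => // t; rewrite start0/= -[leRHS]mulr1.
  by apply: ler_wpM2l => //; case: (started k t).
rewrite -(leeD2rE _ _ fin) -E_D//.
apply: (@le_trans _ _ (E (fun t => C1 * (crossed k t)%:R +
    (alive k t && (n k.+1 t <= a))%:R * psi k.+1 t + C2 * (started k.+1 t)%:R))).
  apply: E_le; last 2 first.
  - exact: measurable_funD.
  - by apply: measurable_funD => //; exact: measurable_funD.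
  by move=> t; rewrite transition andbT addr_ge0.
rewrite E_D//; last 2 first.
- by move=> t; rewrite addr_ge0.
- exact: measurable_funD.
rewrite addeC; apply: leeD2l; apply: (le_trans _ IH).
rewrite E_D// [leRHS]E_D//; apply: leeD2l; exact: drift_step.
Qed.

(** To travel from [lam] to [4 * lam] with increments at most [a], the energy has
    to grow by the factor [C1 / C2]; being a supermartingale after discounting,
    it does so on a small proportion of the paths that ever exceed [lam]. *)
Lemma good_lambda k :
  (P [set t | [&& (4 * lam < runmax x k t)%R, (runmax n k t <= a)%R &
              sumV k t <= b%:E]] <=
  (expR (growth lam th a D * b - th * lam))%:E *
    P [set t | (lam < runmax x k t)%R])%E.
Proof.
have C10 : 0 < C1 by rewrite mulr_gt0 ?expR_gt0.
have C20 : 0 < C2 by rewrite expR_gt0.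
rewrite -(integral_natr_bool P (crossed_measurable k)).
rewrite -(integral_natr_bool P (started_measurable k)).
have eC : expR (growth lam th a D * b - th * lam) = C2 / C1.
  rewrite /C1 /C2 invfM -!expRN -!expRD; congr expR; rewrite -/Gam; ring.
rewrite eC EFinM -muleA muleCA lee_pdivlMl//.
have mnat (f : T -> bool) : measurable_fun setT f ->
    measurable_fun setT (fun t => ((f t)%:R)%:E : \bar R).
  by move=> mf; apply/measurable_EFinP; exact: measurable_natr_bool.
rewrite -!ge0_integralZl_EFin ?(ltW C10) ?(ltW C20)//; try exact: mnat.
apply: (@le_trans _ _ (E (stop_potential k))); last exact: E_stop_potential.
rewrite -[leLHS]/(E (fun t => C1 * (crossed k t)%:R)); apply: E_le.
- move=> t; rewrite mulr_ge0 ?(ltW C10)//= lerDl.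
  by rewrite mulr_ge0// mulr_ge0 ?expR_ge0.
- by apply: measurable_funM => //; exact: measurable_natr_bool.
- apply: measurable_funD; apply: measurable_funM => //.
    exact: measurable_natr_bool.
  exact: measurable_natr_bool.
Qed.

End good_lambda.

(** * Bochner integrals and the reflected increment *)

Section borel_vectors.
Context d (T : measurableType d) (R : realType) (X : normedModType R).
Implicit Types A B : T -> X.

(** Borel measurability tested on generators. *)
Definition open_measurable_fun A : Prop :=
  forall U, open U -> measurable (A @^-1` U).

Lemma open_measurable_comp A (g : X -> X) :
  continuous g -> open_measurable_fun A -> open_measurable_fun (g \o A).
Proof.
move=> cg mA U oU; rewrite comp_preimage; apply: mA.
by move/continuousP : cg; apply.
Qed.

Lemma norm_sub_measurable A (y : X) :
  open_measurable_fun A -> measurable_fun setT (fun t => `|A t - y|).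
Proof.
move=> mA; apply: (measurability _ (RGenOpens.measurableE R)).
move=> _ [_ [a [b ->] <-]]; rewrite setTI.
rewrite (_ : _ @^-1` _ = A @^-1` ((fun v => `|v - y|) @^-1` `]a, b[%classic))//.
apply: mA; have /continuousP : continuous (fun v : X => `|v - y|).
  by move=> v; apply: cvg_norm; apply: cvgB => //; exact: cvg_cst.
by apply; exact: interval_open.
Qed.

Lemma norm_measurable A :
  open_measurable_fun A -> measurable_fun setT (fun t => `|A t|).
Proof.
by move=> /norm_sub_measurable-/(_ 0); under eq_fun do rewrite subr0.
Qed.

Lemma separable_dense_seq :
  separable X -> exists e : nat -> X, forall x r, 0 < r -> exists k, `|x - e k| < r.
Proof.
move=> [S [/countable_injP[c cinj] dS]].
exists (fun k => xget 0 [set s | S s /\ c s = k]) => x r r0.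
have [s [/= xs Ss]] : ball x r `&` S !=set0.
  by apply: dS; [exists x; exact: ballxx|exact: (ball_open x r)].
exists (c s); rewrite (_ : xget _ _ = s).
  by move: xs; rewrite -ball_normE.
case: xgetP => [s' _ [/= Ss' cs]|/(_ s)]; last by case.
by apply: cinj; rewrite ?inE.
Qed.

(** Separability enters through
    [`|A - B| < r] iff [`|A - e| + `|B - e| < r] for some [e] of a dense
    sequence. *)
Lemma norm_diff_measurable A B : separable X ->
  open_measurable_fun A -> open_measurable_fun B ->
  measurable_fun setT (fun t => `|A t - B t|).
Proof.
move=> /separable_dense_seq[e eP] mA mB.
apply: (measurability _ (RGenInftyO.measurableE R)) => //.
move=> _ [_ [r ->] <-]; rewrite setTI.
rewrite (_ : _ @^-1` _ = \bigcup_k [set t | `|A t - e k| + `|B t - e k| < r]).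
  apply: bigcup_measurable => k _; apply: (@measurable_boolset _ T).
  apply: measurable_fun_ltr => //.
  by apply: measurable_funD; exact: norm_sub_measurable.
apply/seteqP; split=> [t /=|t [k _ /=]]; rewrite in_itv/= => h.
  have [|k ek] := eP (B t) ((r - `|A t - B t|) / 2).
    by rewrite divr_gt0// subr_gt0.
  exists k => //=; have := ler_normD (A t - B t) (B t - e k).
  rewrite addrA subrK; lra.
have := ler_normB (A t - e k) (B t - e k).
by rewrite opprB addrA subrK; lra.
Qed.

End borel_vectors.

Section bochner_bound.
Context d (T : measurableType d) (R : realType) (X : normedModType R).
Variable P : probability T R.

Lemma open_measurable_simple (s : T -> X) : simple s -> open_measurable_fun s.
Proof.
move=> [fs ms] U oU.
rewrite (_ : _ @^-1` _ = \bigcup_(v in range s `&` U) s @^-1` [set v]).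
  by apply: fin_bigcup_measurable => // ; exact: finite_setIl.
apply/seteqP; split => t /= => [Ut|[v [_ Uv] ->]//].
by exists (s t) => //; split => //; exists t.
Qed.

Lemma simple_integral_dist (E : set T) (s : T -> X) (y : X) :
  simple s -> measurable E ->
  ((`|fine (P E) *: y - simple_integral P E s|)%:E <=
    \int[P]_(t in E) (`|s t - y|)%:E)%E.
Proof.
move=> ss mE; case: (ss) => fs ms.
pose Es v := E `&` s @^-1` [set v].
have mEs v : measurable (Es v) by exact: measurableI.
have EE : E = \big[setU/set0]_(v <- fset_set (range s)) Es v.
  rewrite -bigcup_fset; apply/seteqP; split=> [t Et|t [v _ []//]].
  by exists (s t) => //=; rewrite in_fset_set// inE; exists t.
have tE : trivIset [set` fset_set (range s)] Es.
  exact: trivIset_preimage1_in.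
have fineE : fine (P E) = \sum_(v <- fset_set (range s)) fine (P (Es v)).
  apply: EFin_inj; rewrite fineK ?fin_num_measure//.
  rewrite -sumEFin [in LHS]EE measure_fbigsetU//.
  by apply: eq_bigr => v _; rewrite fineK ?fin_num_measure.
rewrite /simple_integral fsbig_finite// fineE scaler_suml -sumrB.
rewrite [X in (_ <= \int[_]_(_ in X) _)%E]EE ge0_integral_bigsetU//; last first.
  apply: measurable_funTS; apply/measurable_EFinP; apply: norm_sub_measurable.
  exact: open_measurable_simple.
rewrite (_ : (\sum_(v <- _) _)%E =
    (\sum_(v <- fset_set (range s)) fine (P (Es v)) * `|v - y|)%:E).
  rewrite lee_fin; apply: (le_trans (ler_norm_sum _ _ _)); apply: ler_sum => v _.
  rewrite -scalerBr normrZ distrC ger0_norm// fine_ge0//.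
rewrite -sumEFin; apply: eq_bigr => v _.
rewrite EFinM fineK ?fin_num_measure// muleC.
rewrite -(integral_cst P (mEs v)); apply: eq_integral => t /set_mem[_ ->].
by [].
Qed.

(** The norm inequality for the integral of [f - y] over [E]. Stated with a
    constant [y], it passes to the limit from simple functions without any
    linearity of the integral; a conditional expectation is nearly constant on
    small sets, so this form suffices. *)
Lemma bochner_integral_dist (E : set T) (f : T -> X) (v y : X) :
  separable X -> open_measurable_fun f -> measurable E ->
  is_bochner_integral P E f v ->
  ((`|fine (P E) *: y - v|)%:E <= \int[P]_(t in E) (`|f t - y|)%:E)%E.
Proof.
move=> sX mf mE [s [[ss sf] sv]].
have [->|ffin] := eqVneq (\int[P]_(t in E) (`|f t - y|)%:E)%E +oo%E.
  exact: leey.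
have mfy : measurable_fun E (EFin \o (fun t => `|f t - y|)).
  by apply: measurable_funTS; apply/measurable_EFinP; exact: norm_sub_measurable.
have mfs n : measurable_fun E (EFin \o (fun t => `|f t - s n t|)).
  apply: measurable_funTS; apply/measurable_EFinP; apply: norm_diff_measurable => //.
  exact: open_measurable_simple.
have bound n : ((`|fine (P E) *: y - simple_integral P E (s n)|)%:E <=
    \int[P]_(t in E) (`|f t - s n t|)%:E + \int[P]_(t in E) (`|f t - y|)%:E)%E.
  apply: (le_trans (simple_integral_dist y (ss n) mE)).
  rewrite -ge0_integralD//; last exact: mfs.
  apply: ge0_le_integral => //.
  - apply: measurable_funTS; apply/measurable_EFinP; apply: norm_sub_measurable.
    exact: open_measurable_simple.
  - by apply: emeasurable_funD; [exact: mfs|].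
  move=> t _; rewrite -EFinD lee_fin (distrC (f t)).
  by have := ler_normD (s n t - f t) (f t - y); rewrite addrA subrK.
have L1 : (`|fine (P E) *: y - simple_integral P E (s n)|)%:E @[n --> \oo] -->
    (`|fine (P E) *: y - v|)%:E.
  by apply: cvg_EFin; [exact: nearW|apply: cvg_norm; apply: cvgB => //; exact: cvg_cst].
have L2 : (\int[P]_(t in E) (`|f t - s n t|)%:E + \int[P]_(t in E) (`|f t - y|)%:E)%E
    @[n --> \oo] --> (0 + \int[P]_(t in E) (`|f t - y|)%:E)%E.
  apply: cvgeD => //; exact: cvg_cst.
rewrite -[leRHS]add0e; apply: (lee_cvg_to L1 L2).
exact: nearW.
Qed.

End bochner_bound.

Section reflected_norm.
Context d (T : measurableType d) (R : realType) (X : normedModType R).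
Variables (P : probability T R) (G : set (set T)).
Hypotheses (sG : sigma_algebra setT G) (Gm : G `<=` measurable).
Hypothesis sX : separable X.
Variables g h : T -> X.
Hypothesis mg : measurable_wrt G (@borel_sets X) g.
Hypothesis mh : measurable_wrt measurable (@borel_sets X) h.
Hypothesis gh : forall E, G E -> exists v,
  is_bochner_integral P E h v /\ is_bochner_integral P E g v.

Let openG : forall U : set X, open U -> G (g @^-1` U).
Proof. by move=> U oU; apply: mg; exact: sub_sigma_algebra. Qed.

Let open_g : open_measurable_fun g.
Proof. by move=> U oU; apply: Gm; exact: openG. Qed.

Let open_h : open_measurable_fun h.
Proof. by move=> U oU; apply: mh; exact: sub_sigma_algebra. Qed.

Let open_2g : open_measurable_fun (fun t => 2 *: g t).
Proof.
apply: (open_measurable_comp (g := fun v : X => 2 *: v)) => // v.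
exact: scaler_continuous.
Qed.

Lemma reflected_norm_measurable :
  measurable_fun setT (fun t => `|2 *: g t - h t|).
Proof. exact: norm_diff_measurable. Qed.

Let mnorm_g : measurable_fun setT (fun t => `|g t|).
Proof. exact: norm_measurable. Qed.

Let near_point (E : set T) (x : X) (e : R) : G E ->
  (forall t, E t -> `|g t - x| < e) ->
  (\int[P]_(t in E) (`|g t|)%:E <=
   \int[P]_(t in E) (`|2 *: g t - h t| + 4 * e)%:E)%E.
Proof.
move=> GE gx; have mE := Gm GE.
have [[t Et]|/forallNP noE] := pselect (exists t, E t); last first.
  have -> : E = set0 by apply/seteqP; split => // t /noE.
  by rewrite !integral_set0.
have e0 : 0 <= e by rewrite (le_trans _ (ltW (gx t Et))).
have [v [hv gv]] := gh GE.
have vh := bochner_integral_dist (2 *: x) sX open_h mE hv.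
have vg := bochner_integral_dist x sX open_g mE gv.
have mw : measurable_fun E (fun t => (`|2 *: g t - h t|)%:E).
  by apply: measurable_funTS; apply/measurable_EFinP; exact: reflected_norm_measurable.
pose p := fine (P E).
have Icst c : (\int[P]_(t in E) c%:E = (c * p)%:E)%E.
  by rewrite EFinM fineK ?fin_num_measure// -(integral_cst P mE).
have step1 : (\int[P]_(t in E) (`|g t|)%:E <= ((`|x| + e) * p)%:E)%E.
  rewrite -Icst; apply: ge0_le_integral => //.
  - by apply: measurable_funTS; apply/measurable_EFinP.
  - move=> s Es; rewrite lee_fin.
    by have := ler_normD (g s - x) x; have := gx s Es; rewrite subrK; lra.
have step2 : (\int[P]_(t in E) (`|h t - 2 *: x|)%:E <=
    \int[P]_(t in E) (`|2 *: g t - h t|)%:E + (2 * e * p)%:E)%E.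
  rewrite -Icst -ge0_integralD//; last by move=> s _; rewrite lee_fin mulr_ge0.
  apply: ge0_le_integral => //.
  - by apply: measurable_funTS; apply/measurable_EFinP; exact: norm_sub_measurable.
  - by apply: emeasurable_funD => //; exact: measurable_cst.
  move=> s Es; rewrite -EFinD lee_fin.
  rewrite -[leLHS](_ : `|(h s - 2 *: g s) + (2 *: g s - 2 *: x)| = _); last first.
    by rewrite addrA subrK.
  apply: (le_trans (ler_normD _ _)); rewrite distrC lerD2l.
  by rewrite -scalerBr normrZ ger0_norm// ler_pM2l// ltW// gx.
have step3 : (\int[P]_(t in E) (`|g t - x|)%:E <= (e * p)%:E)%E.
  rewrite -Icst; apply: ge0_le_integral => //.
  - by apply: measurable_funTS; apply/measurable_EFinP; exact: norm_sub_measurable.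
  - by move=> s Es; rewrite lee_fin ltW// gx.
have p0 : 0 <= p by rewrite fine_ge0.
have tri : `|x| * p <= `|p *: (2 *: x) - v| + `|p *: x - v|.
  have pE : p *: (2 *: x) - v - (p *: x - v) = p *: x.
    by rewrite opprB addrA subrK scalerA -scalerBl; congr (_ *: _); ring.
  by have := ler_normB (p *: (2 *: x) - v) (p *: x - v);
    rewrite pE normrZ ger0_norm// mulrC.
apply: (le_trans step1).
under [leRHS]eq_integral do rewrite EFinD.
rewrite ge0_integralD//; last by move=> s _; rewrite lee_fin mulr_ge0.
rewrite Icst.
have := le_trans vh step2; have := le_trans vg step3; rewrite -/p.
have : (0 <= \int[P]_(t in E) (`|2 *: g t - h t|)%:E)%E.
  exact: integral_ge0.
case: (\int[P]_(t in E) (`|2 *: g t - h t|)%:E)%E => [w||]//=.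
  rewrite -!EFinD !lee_fin; lra.
by move=> _ _ _; rewrite leey.
Qed.

(** Conditional Jensen inequality for the norm of [2 g - h], whose conditional
    expectation is [g] when [g] is that of [h]. The set [E] is cut into countably
    many pieces on which [g] stays within [e] of a point of a dense sequence;
    there the averages are compared with that point. *)
Lemma reflected_norm_ge (E : set T) : G E ->
  (\int[P]_(t in E) (`|g t|)%:E <= \int[P]_(t in E) (`|2 *: g t - h t|)%:E)%E.
Proof.
move=> GE; have mE := Gm GE.
have mw : measurable_fun E (fun t => (`|2 *: g t - h t|)%:E).
  by apply: measurable_funTS; apply/measurable_EFinP; exact: reflected_norm_measurable.
have approx e : 0 < e -> (\int[P]_(t in E) (`|g t|)%:E <=
    \int[P]_(t in E) (`|2 *: g t - h t| + 4 * e)%:E)%E.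
  move=> e0; have [q qd] := separable_dense_seq sX.
  pose C k := E `&` [set t | `|g t - q k| < e].
  have measG (B : set T) : G B = @measurable _ (g_sigma_algebraType G) B.
    by rewrite /measurable/= sigma_algebra_id.
  have GC k : G (C k).
    have GN : G [set t | `|g t - q k| < e].
      apply: (openG (U := [set v | `|v - q k| < e])).
      rewrite (_ : [set _ | _] = ball (q k) e); first exact: ball_open.
      by apply/seteqP; split=> w; rewrite -ball_normE /= distrC.
    by move: GE GN; rewrite !measG => mE' mN'; exact: measurableI.
  have GD k : G (seqDU C k).
    move: GC; rewrite measG => GC; apply: measurableD; first by rewrite -measG.
    by apply: bigsetU_measurable => i _; rewrite -measG.
  have CE : E = \bigcup_k seqDU C k.
    rewrite -seqDU_bigcup_eq; apply/seteqP; split=> [t Et|t [k _ []]//].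
    by have [k ?] := qd (g t) e e0; exists k.
  have mD k : measurable (seqDU C k) := Gm (GD k).
  rewrite CE !ge0_integral_bigcup//.
  - apply: lee_nneseries => k _; first by move=> *; exact: integral_ge0.
    by apply: (near_point (x := q k) (GD k)) => t [[]].
  - apply: measurable_funTS; apply/measurable_EFinP; apply: measurable_funD => //.
    exact: reflected_norm_measurable.
  - by move=> t _; rewrite lee_fin addr_ge0// mulr_ge0// ltW.
  - by apply: measurable_funTS; apply/measurable_EFinP.
apply/lee_addgt0Pr => e e0.
have := approx (e / 4); rewrite divr_gt0// => /(_ isT).
move=> /le_trans; apply.
under eq_integral do rewrite EFinD.
rewrite ge0_integralD//; last by move=> s _; rewrite lee_fin mulr_ge0// divr_ge0// ltW.
apply: leeD2l; rewrite (integral_cst P mE (4 * (e/4))%:E).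
rewrite mulrCA divff// mulr1 -[leRHS]mule1; apply: lee_wpmul2l.
  by rewrite lee_fin ltW.
exact: probability_le1.
Qed.

End reflected_norm.

(** * From tails to moments *)

Section layer_cake.
Context (R : realType).
Local Open Scope ereal_scope.

(** The [k]-th step of height [h] of the staircase under [y]: the sum over [k]
    lies between [y - h] and [y], a discrete layer-cake formula. *)
Definition stair (h : R) (y : \bar R) (k : nat) : R :=
  (h * ((k.+1%:R * h)%:E < y)%E%:R)%R.

Lemma stair_ge0 h y k : (0 <= h)%R -> (0 <= stair h y k)%R.
Proof. by move=> h0; rewrite mulr_ge0. Qed.

Lemma sum_stair_le_index h y n : (0 <= h)%R ->
  (\sum_(0 <= k < n) stair h y k <= n%:R * h)%R.
Proof.
move=> h0; elim: n => [|n IH]; first by rewrite big_geq// mul0r.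
rewrite big_nat_recr//= -natr1 mulrDl mul1r; apply: lerD => //.
by rewrite /stair; case: (_ < y); rewrite ?mulr1 ?mulr0.
Qed.

Lemma sum_stair_le h y n : (0 <= h)%R -> 0 <= y ->
  (\sum_(0 <= k < n) stair h y k)%:E <= y.
Proof.
move=> h0 y0; elim: n => [|n IH]; first by rewrite big_geq.
rewrite big_nat_recr//= {2}/stair; case: ltP => [hy|_]; last first.
  by rewrite mulr0 addr0.
apply: le_trans (ltW hy); rewrite lee_fin -natr1 mulrDl mul1r mulr1.
by rewrite lerD2r sum_stair_le_index.
Qed.

Lemma le_sum_stair h (y : R) n : (0 <= h)%R -> (y <= n.+1%:R * h)%R ->
  (y <= h + \sum_(0 <= k < n) stair h y%:E k)%R.
Proof.
move=> h0; elim: n => [|n IH yn]; first by rewrite big_geq// mul1r addr0.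
rewrite big_nat_recr//=; have [/IH|ny] := leP y (n.+1%:R * h)%R.
  by move=> /le_trans; apply; rewrite addrA lerDl stair_ge0.
apply: (le_trans yn); rewrite (eq_big_nat _ _ (F2 := fun=> h)); last first.
  move=> k /andP[_ kn]; rewrite /stair lte_fin (le_lt_trans _ ny) ?mulr1//.
  by rewrite ler_wpM2r// ler_nat ltnW.
rewrite sumr_const_nat subn0 /stair lte_fin ny mulr1 addrA -mulrS -mulrSr.
by rewrite mulr_natl.
Qed.

Context d (T : measurableType d) (P : probability T R).

(** Integrating the tail inequality over [r]; the staircases of step [h]
    replace the Lebesgue integral in [r], at the price of an error [h]. *)
Lemma tail_comparison (X : T -> R) (Y1 Y2 Z : T -> \bar R) (ep : R) :
  (0 <= ep)%R -> (forall t, 0 <= X t)%R ->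
  (forall t, 0 <= Y1 t) -> (forall t, 0 <= Y2 t) -> (forall t, 0 <= Z t) ->
  measurable_fun setT X -> measurable_fun setT Y1 ->
  measurable_fun setT Y2 -> measurable_fun setT Z ->
  (forall r, (0 < r)%R -> P [set t | (r < X t)%R] <=
     P [set t | r%:E < Y1 t] + P [set t | r%:E < Y2 t]
     + ep%:E * P [set t | r%:E < Z t]) ->
  \int[P]_t (X t)%:E <=
  \int[P]_t Y1 t + \int[P]_t Y2 t + ep%:E * \int[P]_t Z t.
Proof.
move=> ep0 X0 Y10 Y20 Z0 mX mY1 mY2 mZ tail.
pose level (W : T -> \bar R) (r : R) := P [set t | r%:E < W t].
pose stairs h (W : T -> \bar R) t := \sum_(0 <= k <oo) (stair h (W t) k)%:E.
have mstair h (W : T -> \bar R) k : measurable_fun setT W ->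
    measurable_fun setT (fun t => (stair h (W t) k)%:E).
  move=> mW; apply/measurable_EFinP; apply: measurable_funM => //.
  by apply: measurable_natr_bool; exact: measurable_fun_lte.
have stairsE h (W : T -> \bar R) : (0 <= h)%R -> measurable_fun setT W ->
    \int[P]_t stairs h W t = \sum_(0 <= k <oo) h%:E * level W (k.+1%:R * h)%R.
  move=> h0 mW; rewrite integral_nneseries//; last 2 first.
  - by move=> k; exact: mstair.
  - by move=> k t _; rewrite lee_fin stair_ge0.
  apply: eq_eseriesr => k _.
  have mlt : measurable_fun setT (fun t => (k.+1%:R * h)%:E < W t).
    exact: measurable_fun_lte.
  rewrite /level -(integral_natr_bool P mlt) -ge0_integralZl_EFin//.
  by apply/measurable_EFinP; exact: measurable_natr_bool.
have mstairs h (W : T -> \bar R) : (0 <= h)%R -> measurable_fun setT W ->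
    measurable_fun setT (stairs h W).
  move=> h0 mW; apply: (ge0_emeasurable_sum (P := xpredT)) => k => [t _ _|_].
    by rewrite lee_fin stair_ge0.
  exact: mstair.
have stairs_le h (W : T -> \bar R) : (0 <= h)%R ->
    measurable_fun setT W -> (forall t, 0 <= W t) ->
    \int[P]_t stairs h W t <= \int[P]_t W t.
  move=> h0 mW W0; apply: ge0_le_integral => //.
  - by move=> t _; apply: nneseries_ge0 => k _ _; rewrite lee_fin stair_ge0.
  - exact: mstairs.
  move=> t _; apply: lime_le.
    by apply: is_cvg_nneseries => k _ _; rewrite lee_fin stair_ge0.
  by apply: nearW => n; rewrite sumEFin; exact: sum_stair_le.
have le_stairs h : (0 < h)%R ->
    \int[P]_t (X t)%:E <= h%:E + \int[P]_t stairs h (EFin \o X) t.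
  move=> h0; have -> : h%:E = \int[P]_t (cst h%:E) t.
    by rewrite integral_cst// -[RHS]/(h%:E * P setT) probability_setT mule1.
  have mXE : measurable_fun setT (EFin \o X) by exact/measurable_EFinP.
  have st0 t : 0 <= stairs h (EFin \o X) t.
    by apply: nneseries_ge0 => k _ _; rewrite lee_fin stair_ge0// ltW.
  have mst := mstairs h _ (ltW h0) mXE.
  rewrite -ge0_integralD//; last by move=> t _; rewrite lee_fin ltW.
  apply: ge0_le_integral => //.
  - by move=> t _; rewrite lee_fin.
  - exact: emeasurable_funD.
  move=> t _.
  pose n := Num.truncn (X t / h).
  have Xn : (X t <= n.+1%:R * h)%R.
    by rewrite -ler_pdivrMr// ltW// truncnS_gt.
  apply: (@le_trans _ _ (h%:E + \sum_(0 <= k < n) (stair h (X t)%:E k)%:E)).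
    by rewrite sumEFin -EFinD lee_fin le_sum_stair// ltW.
  apply: leeD2l; apply: nneseries_lim_ge => k _ _.
  by rewrite lee_fin stair_ge0// ltW.
have main h : (0 < h)%R -> \int[P]_t (X t)%:E <=
    \int[P]_t Y1 t + \int[P]_t Y2 t + ep%:E * \int[P]_t Z t + h%:E.
  move=> h0; apply: (le_trans (le_stairs _ h0)); rewrite [leRHS]addeC; apply: leeD2l.
  have h0' := ltW h0.
  apply: (@le_trans _ _ (\int[P]_t stairs h Y1 t + \int[P]_t stairs h Y2 t +
      ep%:E * \int[P]_t stairs h Z t)); last first.
    apply: leeD; first by apply: leeD; exact: stairs_le.
    by apply: lee_wpmul2l; [rewrite lee_fin|exact: stairs_le].
  have lev0 (W : T -> \bar R) k : 0 <= h%:E * level W (k.+1%:R * h)%R.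
    by rewrite mule_ge0 ?lee_fin.
  rewrite !stairsE//; last exact/measurable_EFinP.
  rewrite -nneseriesZl// -!nneseriesD//; last 2 first.
  - by move=> k _ _; rewrite adde_ge0.
  - by move=> k _ _; rewrite mule_ge0// lee_fin.
  apply: lee_nneseries => // k _.
  rewrite muleCA -!ge0_muleDr ?adde_ge0 ?mule_ge0 ?lee_fin//.
  apply: lee_wpmul2l; first by rewrite lee_fin.
  by apply: tail; rewrite mulr_gt0.
by apply/lee_addgt0Pr => e e0; exact: main.
Qed.

End layer_cake.

(** * Powers and constants *)

Lemma measurable_ereal_sup d (T : measurableType d) (R : realType)
    (f : nat -> T -> \bar R) : (forall n, measurable_fun setT (f n)) ->
  measurable_fun setT (fun t => ereal_sup (range (f^~ t))).
Proof.
move=> mf; have := measurable_fun_esups mf 0%N.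
rewrite (_ : (fun x => esups (f^~ x) 0%N) =
  (fun t => ereal_sup (range (f^~ t))))//.
apply/funext => t; rewrite /esups /sdrop/=; congr (ereal_sup (_ @` _)).
by apply/seteqP; split.
Qed.

Section poweR_order.
Context (R : realType).
Local Open Scope ereal_scope.

Lemma le_poweR (x y : \bar R) (p : R) :
  (0 <= p)%R -> 0 <= x -> x <= y -> x `^ p <= y `^ p.
Proof.
move=> p0 x0 xy; apply: (gt0_ler_poweR p0) => //; rewrite in_itv/= ?leey ?andbT//.
exact: le_trans xy.
Qed.

Lemma powR_lt_poweR (x : R) (y : \bar R) (p : R) :
  (0 < p)%R -> (0 <= x)%R -> x%:E < y -> (x `^ p)%:E < y `^ p.
Proof.
move=> p0 x0; case: y => [y||]//; last by rewrite poweRyr ?gt_eqF// ?ltry.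
by rewrite !lte_fin => xy; rewrite gt0_ltr_powR// nnegrE// (le_trans x0)// ltW.
Qed.

Lemma powR_superadditive (x y p : R) : (0 <= x)%R -> (0 <= y)%R -> (1 <= p)%R ->
  (x `^ p + y `^ p <= (x + y) `^ p)%R.
Proof.
move=> x0 y0 p1; have p0 := lt_le_trans ltr01 p1.
rewrite -(mulr_powRB1 x0 p0) -(mulr_powRB1 y0 p0).
rewrite -(mulr_powRB1 (addr_ge0 x0 y0) p0) mulrDl;
  apply: lerD; apply: ler_wpM2l => //;
  apply: ge0_ler_powR; rewrite ?nnegrE ?subr_ge0 ?lerDl ?lerDr//;
  exact: addr_ge0.
Qed.

Lemma poweR_superadditive (x y : \bar R) (p : R) : 0 <= x -> 0 <= y ->
  (1 <= p)%R -> x `^ p + y `^ p <= (x + y) `^ p.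
Proof.
move=> x0 y0 p1; have p0 := lt_le_trans ltr01 p1.
case: x x0 => [x||]// x0; last first.
  by rewrite [(+oo + y)]addye ?gt_eqF ?(lt_le_trans _ y0)// [leRHS]poweRyr
    ?leey ?gt_eqF.
case: y y0 => [y||]// y0; last by rewrite [leRHS]poweRyr ?leey ?gt_eqF.
rewrite -[leLHS]/((x `^ p + y `^ p)%R%:E) -[leRHS]/(((x + y) `^ p)%R%:E).
by rewrite lee_fin powR_superadditive.
Qed.

End poweR_order.

(** With [th = 7 p / lam] the gain [th * lam] is [7 p], whatever [c]. The jump
    bound is chosen so that [th * a = p / c], and the factor [expR (p / c)] in the
    bound on the square function then keeps each of the three costs in [growth]
    of order [p]: at most [p], [p] and [2 p]. *)
Lemma level_exponent (R : realType) (lam p c D : R) :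
  0 < lam -> 1 <= c -> c <= p -> 1 <= D ->
  growth lam (7 * p / lam) (lam / (7 * c)) D *
    (lam / (7 * Num.sqrt c * expR (p / c) * D)) ^+ 2 - 7 * p / lam * lam
  <= - (3 * p).
Proof.
move=> lam0 c1 cp D1.
have c0 : 0 < c := lt_le_trans ltr01 c1.
have p0 : 0 < p := lt_le_trans c0 cp.
have D0 : 0 < D := lt_le_trans ltr01 D1.
have q0 : 0 <= p / c by rewrite divr_ge0// ltW.
have E0 : 0 < expR (p / c) := expR_gt0 _.
have E1 := expR_ge1Dx (p / c).
have ea : 7 * p / lam * (lam / (7 * c)) = p / c.
  by field; rewrite !gt_eqF.
have eb : (lam / (7 * Num.sqrt c * expR (p / c) * D)) ^+ 2 =
    lam ^+ 2 / (49 * c * expR (p / c) ^+ 2 * D ^+ 2).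
  rewrite expr_div_n !exprMn sqr_sqrtr ?ltW//; congr (_ / (_ * _ * _ * _)).
  by rewrite -natrX.
rewrite /growth ea eb; move: E0 E1; set E := expR _ => E0 E1.
have -> : (7 * p / lam / (lam / (7 * c)) + 7 * p / lam * D ^+ 2 / lam +
     2 * (7 * p / lam) ^+ 2 * D ^+ 2 * E) *
    (lam ^+ 2 / (49 * c * E ^+ 2 * D ^+ 2)) - 7 * p / lam * lam =
  p / (E ^+ 2 * D ^+ 2) + p / (7 * c * E ^+ 2) + 2 * p * ((p / c) / E) - 7 * p.
  by field; rewrite !gt_eqF.
have EE : 1 <= E ^+ 2 by apply: exprn_ege1; lra.
have DD : 1 <= D ^+ 2 by apply: exprn_ege1.
have t1 : p / (E ^+ 2 * D ^+ 2) <= p.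
  by rewrite ler_pdivrMr ?mulr_gt0 ?exprn_gt0// ler_peMr ?(ltW p0)// mulr_ege1.
have t2 : p / (7 * c * E ^+ 2) <= p.
  rewrite ler_pdivrMr ?mulr_gt0 ?exprn_gt0// ler_peMr ?(ltW p0)//.
  by apply: mulr_ege1 => //; lra.
have t3 : 2 * p * (p / c / E) <= 2 * p.
  rewrite ler_piMr ?mulr_ge0 ?(ltW p0)// ler_pdivrMr// mul1r; lra.
lra.
Qed.

Lemma powR8_le_expR3 (R : realType) (p : R) : 0 <= p -> 8 `^ p <= expR (3 * p).
Proof.
move=> p0; rewrite /powR gt_eqF// ler_expR mulrC; apply: ler_wpM2r => //.
rewrite -ler_expR lnK ?posrE// (_ : 3 = 1 + 1 + 1 :> R); last by ring.
have := expR_ge1Dx (1 : R); rewrite !expRD; set e := expR 1 => e2.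
have : 2 * 2 * 2 <= e * e * e by rewrite !ler_pM ?mulr_ge0//; lra.
lra.
Qed.

(** * Moments of a norm process *)

Section moments.
Context d (T : measurableType d) (R : realType) (P : probability T R).
Variables (F : nat -> set (set T)) (D : R) (x n z : nat -> T -> R).
Variable V : nat -> T -> \bar R.
Hypothesis xnzV : norm_process P F D x n z V.
Hypothesis D1 : 1 <= D.
Hypothesis n_ge0 : forall j t, 0 <= n j t.
Variables p c : R.
Hypotheses (c1 : 1 <= c) (cp : c <= p).
Local Open Scope ereal_scope.

Let sup_of (y : nat -> T -> R) (t : T) : \bar R :=
  ereal_sup (range (fun j => (y j t)%:E)).
Let sqfun (t : T) : \bar R := sqrte (\sum_(1 <= j <oo) V j t).
Let M := runmax x.
Let alpha : R := (7 * c)%R.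
Let beta : R := (7 * Num.sqrt c * expR (p / c) * D)%R.
Let Y1 t := (alpha%:E * sup_of n t) `^ p.
Let Y2 t := (beta%:E * sqfun t) `^ p.

Let filtF := np_filtration xnzV.
Let c0 : (0 < c)%R := lt_le_trans ltr01 c1.
Let p0 : (0 < p)%R := lt_le_trans c0 cp.
Let D0 : (0 < D)%R := lt_le_trans ltr01 D1.
Let alpha0 : (0 < alpha)%R. Proof. by rewrite mulr_gt0. Qed.
Let beta0 : (0 < beta)%R.
Proof. by rewrite !mulr_gt0 ?sqrtr_gt0 ?expR_gt0. Qed.

Let n_measurable j : measurable_fun setT (n j).
Proof.
exact: (adapted_measurable filtF (@np_n_adapted _ _ _ _ _ _ _ _ _ _ xnzV j)).
Qed.

Let M_measurable k : measurable_fun setT (M k).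
Proof.
apply: (adapted_measurable filtF (i := k)); apply: (runmax_adapted filtF) => j.
exact: (@np_x_adapted _ _ _ _ _ _ _ _ _ _ xnzV j).
Qed.

Let M_ge0 k t : (0 <= M k t)%R.
Proof. exact: le_trans (np_x_ge0 xnzV k t) (runmax_ge x k t). Qed.

Let sup_ge y j t : (y j t)%:E <= sup_of y t.
Proof. by apply: ereal_sup_ubound; exists j. Qed.

Let runmax_sup y k t : (runmax y k t)%:E <= sup_of y t.
Proof. by elim: k => [|k IH] //=; rewrite EFin_max ge_max IH sup_ge. Qed.

Let sup_measurable y : (forall j, measurable_fun setT (y j)) ->
  measurable_fun setT (sup_of y).
Proof.
by move=> my; apply: measurable_ereal_sup => j; exact/measurable_EFinP.
Qed.

Let sup_n_ge0 t : 0 <= sup_of n t.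
Proof. by apply: le_trans (sup_ge n 0%N t); rewrite lee_fin. Qed.

Let V_ge0 k t : (1 <= k)%N -> 0 <= V k t.
Proof. by case: k => // k _; exact: (np_V_ge0 xnzV). Qed.

Let sumV_cvg t : sumV V k t @[k --> \oo] --> \sum_(1 <= j <oo) V j t.
Proof.
have : cvgn (fun k => \sum_(1 <= i < k) V i t).
  by apply: is_cvg_nneseries => k k1 _; exact: V_ge0.
by move/cvg_ex => [l lE]; rewrite (cvg_lim _ lE)//; move: lE; rewrite -cvg_shiftS.
Qed.

Let sumV_le k t : sumV V k t <= \sum_(1 <= j <oo) V j t.
Proof. by apply: nneseries_lim_ge => j j1 _; exact: V_ge0. Qed.

Let sumV_measurable k : measurable_fun setT (sumV V k).
Proof. exact: (@sumV_measurable _ _ _ _ _ _ _ _ _ _ xnzV k). Qed.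

Let sqfun_measurable : measurable_fun setT sqfun.
Proof.
have mV : measurable_fun setT (fun t => \sum_(1 <= j <oo) V j t).
  apply: (@emeasurable_fun_cvg _ _ _ _ (sumV V)) => [k|t _].
    exact: (@sumV_measurable k).
  exact: sumV_cvg.
rewrite (_ : sqfun = fun t => (\sum_(1 <= j <oo) V j t) `^ 2^-1).
  exact: (measurableT_comp (measurable_poweR _)).
apply/funext => t; rewrite poweR12_sqrt//.
by apply: nneseries_ge0 => j j1 _; exact: V_ge0.
Qed.

Let Y1_measurable : measurable_fun setT Y1.
Proof.
apply: (measurableT_comp (measurable_poweR _)); apply: measurable_funeM.
exact: sup_measurable.
Qed.

Let Y2_measurable : measurable_fun setT Y2.
Proof.
apply: (measurableT_comp (measurable_poweR _)); exact: measurable_funeM.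
Qed.

(* Either an increment exceeds [lam / alpha], or the square function exceeds
   [lam / beta], or the level-crossing estimate applies, where [lam ^ p = r]. *)
Let tail k r : (0 < r)%R -> P [set t | (r < (M k t / 4) `^ p)%R] <=
   P [set t | r%:E < Y1 t] + P [set t | r%:E < Y2 t] +
   (expR (- (3 * p)))%:E * P [set t | r%:E < ((M k t) `^ p)%:E].
Proof.
move=> r0.
pose lam := (r `^ p^-1)%R.
have lam0 : (0 < lam)%R by rewrite powR_gt0.
have lamp : (lam `^ p)%R = r.
  by rewrite /lam -powRrM mulVf ?gt_eqF// powRr1// ltW.
pose a := (lam / alpha)%R; pose b := ((lam / beta) ^+ 2)%R.
pose th := (7 * p / lam)%R.
have a0 : (0 < a)%R by rewrite divr_gt0.
have a_lam : (a <= lam)%R.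
  rewrite ler_pdivrMr// ler_peMr ?(ltW lam0)// /alpha; move: c1; lra.
have th0 : (0 < th)%R by rewrite divr_gt0// mulr_gt0.
have b0 : (0 <= b)%R by exact: sqr_ge0.
pose B := [set t | [&& (4 * lam < M k t)%R, (runmax n k t <= a)%R &
              sumV V k t <= b%:E]].
have m1 : measurable [set t | r%:E < Y1 t].
  by apply: measurable_boolset; exact: measurable_fun_lte.
have m2 : measurable [set t | r%:E < Y2 t].
  by apply: measurable_boolset; exact: measurable_fun_lte.
have mB : measurable B.
  apply: measurable_boolset; apply: measurable_and; first exact: measurable_fun_ltr.
  apply: measurable_and.
    apply: measurable_fun_ler => //.
    apply: (adapted_measurable filtF (i := k)); apply: (runmax_adapted filtF) => j.
    exact: (@np_n_adapted _ _ _ _ _ _ _ _ _ _ xnzV j).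
  by apply: measurable_fun_lee => //; exact: (@sumV_measurable k).
have incl : [set t | (r < (M k t / 4) `^ p)%R] `<=`
    [set t | r%:E < Y1 t] `|` [set t | r%:E < Y2 t] `|` B.
  move=> t /= rM.
  have lamM : (4 * lam < M k t)%R.
    rewrite mulrC -ltr_pdivlMr// ltNge; apply/negP => h; move: rM; apply/negP.
    rewrite -leNgt -lamp ge0_ler_powR ?(ltW p0)// nnegrE ?divr_ge0//.
    exact: ltW.
  have [na|an] := leP (runmax n k t) a; last first.
    left; left; rewrite /Y1 -lamp; apply: powR_lt_poweR => //; first exact: ltW.
    rewrite -lte_pdivrMl// -EFinM mulrC.
    by apply: lt_le_trans (runmax_sup n k t); rewrite lte_fin.
  have [Vb|bV] := leP (sumV V k t) b%:E; last first.
    left; right; rewrite /Y2 -lamp; apply: powR_lt_poweR => //; first exact: ltW.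
    rewrite -lte_pdivrMl// -EFinM mulrC.
    have -> : (lam / beta)%R%:E = sqrte b%:E.
      by rewrite /= sqrtr_sqr ger0_norm// divr_ge0// ltW.
    rewrite ltNge lee_sqrt ?lee_fin// -ltNge.
    exact: (lt_le_trans bV (sumV_le k t)).
  by right; apply/and3P.
have bad := good_lambda xnzV D1 b lam0 a0 a_lam th0 k.
have mMp : measurable_fun setT (fun t => (M k t `^ p)%:E).
  by apply/measurable_EFinP; exact: (measurableT_comp (measurable_powR p)).
have mL : measurable [set t | (lam < M k t)%R].
  by apply: measurable_boolset; exact: measurable_fun_ltr.
have mX : measurable [set t | (r < (M k t / 4) `^ p)%R].
  apply: measurable_boolset; apply: measurable_fun_ltr => //.
  by apply: (measurableT_comp (measurable_powR p)); exact: measurable_funM.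
apply: (@le_trans _ _ (P ([set t | r%:E < Y1 t] `|` [set t | r%:E < Y2 t] `|` B))).
  by apply: le_measure; rewrite ?inE//; apply: measurableU => //; exact: measurableU.
apply: (le_trans (measureU2 _ (measurableU _ _ m1 m2) mB)).
apply: leeD; first exact: measureU2.
apply: (le_trans bad); apply: lee_pmul => //.
  by rewrite lee_fin ler_expR; exact: level_exponent.
have mZ : measurable [set t | r%:E < (M k t `^ p)%:E].
  by apply: measurable_boolset; exact: measurable_fun_lte.
apply: le_measure; rewrite ?inE// => t /= lamM.
by rewrite lte_fin -lamp gt0_ltr_powR ?nnegrE// (ltW lam0).
Qed.

(* The factor [expR (- (3 * p)) <= 8 `^ (- p)] beats the loss [4 `^ p] due to the
   dilation of the level, so the moment of [M k] can be absorbed. It is finite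
   because [M k <= k * sup n]. *)
Let moment_le k : \int[P]_t ((M k t) `^ p)%:E <=
  (8 `^ p)%:E * (\int[P]_t Y1 t + \int[P]_t Y2 t).
Proof.
have I1 : 0 <= \int[P]_t Y1 t by apply: integral_ge0 => t _; exact: poweR_ge0.
have I2 : 0 <= \int[P]_t Y2 t by apply: integral_ge0 => t _; exact: poweR_ge0.
pose X t := ((M k t / 4) `^ p)%R.
have mX : measurable_fun setT X.
  by apply: (measurableT_comp (measurable_powR p)); exact: measurable_funM.
have mMp : measurable_fun setT (fun t => (M k t `^ p)%:E).
  by apply/measurable_EFinP; exact: (measurableT_comp (measurable_powR p)).
have XE : \int[P]_t (M k t `^ p)%:E = (4 `^ p)%:E * \int[P]_t (X t)%:E.
  rewrite -ge0_integralZl_EFin ?powR_ge0//; last 2 first.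
  - by move=> t _; rewrite lee_fin powR_ge0.
  - exact/measurable_EFinP.
  apply: eq_integral => t _; rewrite -EFinM /X -powRM ?divr_ge0//.
  by rewrite mulrC divfK.
have main : \int[P]_t (X t)%:E <= \int[P]_t Y1 t + \int[P]_t Y2 t +
    (expR (- (3 * p)))%:E * \int[P]_t (M k t `^ p)%:E.
  apply: tail_comparison => //; rewrite ?expR_ge0//.
  - by move=> t; exact: powR_ge0.
  - by move=> t; exact: poweR_ge0.
  - by move=> t; exact: poweR_ge0.
  - by move=> t; rewrite lee_fin powR_ge0.
  - exact: tail.
have Mn t : (M k t <= k%:R * runmax n k t)%R.
  elim: k {X mX mMp XE main} => [|k IH]; first by rewrite /M /= (np_init xnzV) mul0r.
  have n_le := runmax_ge n k.+1 t; have x_le := runmax_ge x k t.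
  have := np_x_step xnzV k t; rewrite ler_norml => /andP[_ step].
  have N0 : (0 <= runmax n k t)%R := le_trans (n_ge0 k t) (runmax_ge n k t).
  have NS : (runmax n k t <= runmax n k.+1 t)%R by rewrite /= le_max lexx.
  have kN : (k%:R * runmax n k t <= k%:R * runmax n k.+1 t)%R.
    exact: ler_wpM2l.
  rewrite (_ : M k.+1 t = Num.max (M k t) (x k.+1 t))//.
  rewrite ge_max -natr1 mulrDl mul1r; apply/andP; split.
    rewrite -[leLHS]addr0; apply: lerD; first exact: le_trans IH kN.
    exact: le_trans N0 NS.
  move: step n_le (le_trans (le_trans x_le IH) kN).
  move: (x k.+1 t) (x k t) (k%:R * runmax n k.+1 t)%R (runmax n k.+1 t) (n k.+1 t).
  by move=> a1 a2 a3 a4 a5; lra.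
have fin : \int[P]_t Y1 t < +oo -> \int[P]_t (X t)%:E < +oo.
  move=> Y1fin.
  pose C := ((k%:R / alpha) `^ p)%R.
  apply: (@le_lt_trans _ _ (C%:E * \int[P]_t Y1 t)); last first.
    by rewrite lte_mul_pinfty ?lee_fin ?powR_ge0.
  rewrite -ge0_integralZl_EFin ?powR_ge0//; last first.
    by move=> t _; exact: poweR_ge0.
  apply: ge0_le_integral => //.
  - by move=> t _; rewrite lee_fin powR_ge0.
  - exact/measurable_EFinP.
  - exact: measurable_funeM.
  move=> t _; rewrite -[C%:E]/((k%:R / alpha)%R%:E `^ p) -poweRM; last 2 first.
  - by rewrite lee_fin divr_ge0// ltW.
  - by rewrite mule_ge0// lee_fin ltW.
  rewrite muleA -EFinM divfK ?gt_eqF// -[(X t)%:E]/((M k t / 4)%R%:E `^ p).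
  apply: le_poweR; rewrite ?(ltW p0) ?lee_fin ?divr_ge0//.
  apply: (@le_trans _ _ (k%:R * runmax n k t)%R%:E).
    rewrite lee_fin; apply: le_trans (Mn t).
    by rewrite ler_pdivrMr// ler_peMr// ler1n.
  by rewrite EFinM; apply: lee_wpmul2l; rewrite ?lee_fin.
have [I1fin|] := ltP (\int[P]_t Y1 t) +oo; last first.
  rewrite leye_eq => /eqP ->; rewrite addye; last first.
    by rewrite gt_eqF// (lt_le_trans _ I2).
  by rewrite gt0_muley ?leey// lte_fin powR_gt0.
have [I2fin|] := ltP (\int[P]_t Y2 t) +oo; last first.
  rewrite leye_eq => /eqP ->; rewrite addey; last first.
    by rewrite gt_eqF// (lt_le_trans _ I1).
  by rewrite gt0_muley ?leey// lte_fin powR_gt0.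
have := fin I1fin; move: main; rewrite XE.
have IX : 0 <= \int[P]_t (X t)%:E.
  by apply: integral_ge0 => t _; rewrite lee_fin powR_ge0.
move: IX I1 I2 I1fin I2fin.
move: (\int[P]_t Y1 t) (\int[P]_t Y2 t) (\int[P]_t (X t)%:E).
case=> [s1||]// [s2||]// [B||]// B0 s10 s20 _ _ + _.
rewrite !lee_fin in B0 s10 s20 *.
move=> main.
have p1 : (1 <= p)%R := le_trans c1 cp.
have e8 := powR8_le_expR3 (ltW p0).
have w8 : (8 `^ p = 4 `^ p * 2 `^ p :> R)%R by rewrite -powRM// -natrM.
have v2 : (2 <= 2 `^ p :> R)%R by rewrite le1r_powR// ler1n.
have w0 : (0 < 4 `^ p :> R)%R by rewrite powR_gt0.
have eps : (expR (- (3 * p)) * (4 `^ p * B) <= B / 2)%R.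
  have e0 : (0 < expR (3 * p))%R := expR_gt0 _.
  rewrite expRN ler_pdivrMl// mulrCA mulrA; move: e8; rewrite w8 => e8.
  have : (4 `^ p * 2 <= expR (3 * p))%R.
    by apply: le_trans e8; rewrite ler_pM2l.
  move=> /(ler_wpM2r B0); lra.
have : (4 `^ p * B <= 4 `^ p * (2 * (s1 + s2)))%R by rewrite ler_pM2l//; lra.
move=> /le_trans; apply; rewrite w8 -mulrA ler_pM2l// ler_wpM2r// addr_ge0//.
Qed.

Let M_nondecreasing t : nondecreasing_seq (fun k => ((M k t) `^ p)%:E).
Proof.
apply/nondecreasing_seqP => k; rewrite lee_fin ge0_ler_powR ?(ltW p0) ?nnegrE//.
by rewrite [leRHS]/(Num.max (M k t) (x k.+1 t)) le_max lexx.
Qed.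

Let sup_x_ge0 t : 0 <= sup_of x t.
Proof. by apply: le_trans (sup_ge x 0%N t); rewrite lee_fin (np_x_ge0 xnzV). Qed.

Let sup_powR t : (sup_of x t) `^ p = limn (fun k => ((M k t) `^ p)%:E).
Proof.
have -> := cvg_lim _ (ereal_nondecreasing_cvgn (M_nondecreasing t)) => //.
set s := ereal_sup _; apply/eqP; rewrite eq_le; apply/andP; split.
  have Ms k : ((M k t) `^ p)%:E <= s by apply: ereal_sup_ubound; exists k.
  have s0 : 0 <= s by apply: le_trans (Ms 0%N); rewrite lee_fin powR_ge0.
  rewrite -(poweRe1 s0) -(mulVf (lt0r_neq0 p0)) poweRrM.
  apply: le_poweR => //; first exact: ltW.
  apply: ge_ereal_sup => _ [j _ <-].
  have -> : (x j t)%:E = ((x j t `^ p)%:E) `^ p^-1.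
    by rewrite poweR_EFin -powRrM divff ?gt_eqF// powRr1// (np_x_ge0 xnzV).
  apply: le_poweR; rewrite ?invr_ge0 ?(ltW p0) ?lee_fin ?powR_ge0//.
  apply: le_trans (Ms j); rewrite lee_fin ge0_ler_powR ?(ltW p0) ?nnegrE//.
    exact: (np_x_ge0 xnzV).
  exact: runmax_ge.
apply: ge_ereal_sup => _ [k _ <-]; rewrite -poweR_EFin.
by apply: le_poweR; rewrite ?(ltW p0) ?lee_fin ?runmax_sup.
Qed.

Let sup_moment_le : \int[P]_t (sup_of x t) `^ p <=
  (8 `^ p)%:E * (\int[P]_t Y1 t + \int[P]_t Y2 t).
Proof.
under eq_integral do rewrite sup_powR.
have mMp k : measurable_fun setT (fun t => ((M k t) `^ p)%:E).
  by apply/measurable_EFinP; exact: (measurableT_comp (measurable_powR p)).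
rewrite monotone_convergence//; last first.
  by move=> k t _; rewrite lee_fin powR_ge0.
apply: lime_le; last by apply: nearW => k; exact: moment_le.
apply: ereal_nondecreasing_is_cvgn => i j ij; apply: ge0_le_integral => //.
- by move=> t _; rewrite lee_fin powR_ge0.
- by move=> t _; exact: M_nondecreasing.
Qed.

Let Lnorm_ge0E (f : T -> \bar R) : (forall t, 0 <= f t) ->
  Lnorm P p%:E f = (\int[P]_t (f t) `^ p) `^ p^-1.
Proof.
move=> f0; rewrite unlock; congr (_ `^ _); apply: eq_integral => t _.
by rewrite gee0_abs.
Qed.

Let scaled_moment (f : T -> \bar R) (a : R) : (0 <= a)%R ->
  (forall t, 0 <= f t) -> measurable_fun setT f ->
  \int[P]_t (a%:E * f t) `^ p = (a%:E * Lnorm P p%:E f) `^ p.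
Proof.
move=> a0 f0 mf; rewrite Lnorm_ge0E// poweRM ?lee_fin ?poweR_ge0//.
have If : 0 <= \int[P]_t (f t) `^ p by apply: integral_ge0 => t _; exact: poweR_ge0.
rewrite -poweRrM mulVf ?gt_eqF// poweRe1// poweR_EFin.
rewrite -ge0_integralZl_EFin ?powR_ge0//; last 2 first.
- by move=> t _; exact: poweR_ge0.
- exact: (measurableT_comp (measurable_poweR p)).
by apply: eq_integral => t _; rewrite poweRM ?lee_fin// poweR_EFin.
Qed.

Lemma norm_process_Lnorm_le :
  Lnorm P p%:E (fun t => ereal_sup (range (fun j => (x j t)%:E))) <=
  56%:E * (c%:E * Lnorm P p%:E (fun t => ereal_sup (range (fun j => (n j t)%:E)))
    + (Num.sqrt c * expR (p / c) * D)%:E * Lnorm P p%:E (square_function V)).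
Proof.
have S0 t : 0 <= sqfun t by exact: sqrte_ge0.
rewrite -[square_function V]/sqfun -[X in Lnorm _ _ X <= _]/(sup_of x).
rewrite -[X in _ * Lnorm _ _ X + _]/(sup_of n).
have mx : measurable_fun setT (sup_of n) by exact: sup_measurable.
set Nd := Lnorm P p%:E (sup_of n); set Ns := Lnorm P p%:E sqfun.
have Nd0 : 0 <= Nd by exact: Lnorm_ge0.
have Ns0 : 0 <= Ns by exact: Lnorm_ge0.
have p1 : (1 <= p)%R := le_trans c1 cp.
have an0 : 0 <= alpha%:E * Nd by rewrite mule_ge0// lee_fin ltW.
have bn0 : 0 <= beta%:E * Ns by rewrite mule_ge0// lee_fin ltW.
rewrite Lnorm_ge0E//.
apply: (@le_trans _ _ (((8%:E * (alpha%:E * Nd + beta%:E * Ns)) `^ p) `^ p^-1)).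
  apply: le_poweR; rewrite ?invr_ge0 ?(ltW p0)//.
    by apply: integral_ge0 => t _; exact: poweR_ge0.
  apply: (le_trans sup_moment_le).
  rewrite (@scaled_moment (sup_of n)) ?(ltW alpha0)//.
  rewrite (@scaled_moment sqfun) ?(ltW beta0)//.
  rewrite [leRHS]poweRM ?lee_fin ?adde_ge0// poweR_EFin.
  by apply: lee_wpmul2l; rewrite ?lee_fin ?powR_ge0// poweR_superadditive.
rewrite -poweRrM divff ?gt_eqF// poweRe1; last first.
  by rewrite mule_ge0 ?adde_ge0// lee_fin.
rewrite /alpha /beta -!mulrA ![(7 * _)%R%:E]EFinM -!muleA -ge0_muleDr; last 2 first.
- by rewrite mule_ge0// lee_fin ltW.
- by rewrite mule_ge0// lee_fin !mulr_ge0 ?sqrtr_ge0 ?expR_ge0// ltW.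
by rewrite !mulrA muleA -EFinM -natrM.
Qed.

End moments.

(** * Martingales and the choice of c *)

Section martingale_norms.
Context (R : realType) (X : normedModType R) (D : R).
Context d (T : measurableType d) (P : probability T R).
Variables (F : nat -> set (set T)) (f : nat -> T -> X) (V : nat -> T -> \bar R).
Hypotheses (smX : smooth2 X D) (sX : separable X).
Hypotheses (mf : martingale0 P F f) (VE : predictable_squares P F f V).

Let reflected (j : nat) (t : T) : R :=
  if j is i.+1 then `|2 *: f i t - f j t| else 0.

Let f_adapted j (U : set X) : open U -> F j (f j @^-1` U).
Proof.
by case: mf => _ _ _ /(_ j)[+ _ _] oU; apply; exact: sub_sigma_algebra.
Qed.

Let f_open_measurable i j : (i <= j)%N ->
  @open_measurable_fun _ (g_sigma_algebraType (F j)) R X (f i).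
Proof.
move=> ij U oU; apply: sub_sigma_algebra.
by case: mf => filtF _ _ _; apply: (filtration_le filtF ij); exact: f_adapted.
Qed.

(** The reflected vector [f_j - d_(j+1)] is [2 f_j - f_(j+1)], whose conditional
    expectation given [F j] is [f_j]. *)
Lemma martingale_norm_process :
  norm_process P F D (fun j t => `|f j t|) (fun j t => `|mdiff f j t|)
    reflected V.
Proof.
case: mf => filtF f0 fint fcond; have [sF Fm _] := filtF.
have df j t : mdiff f j.+1 t = f j.+1 t - f j t by [].
have reflE j t : 2 *: f j t - f j.+1 t = f j t - mdiff f j.+1 t.
  by rewrite df opprB addrA -mulr2n scaler_nat.
have condE j E : F j E -> exists v,
    is_bochner_integral P E (f j.+1) v /\ is_bochner_integral P E (f j) v.
  by case: (fcond j) => _ _; exact.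
split => //.
- by move=> t; rewrite f0 normr0.
- by case=> [|j] t //=.
- by move=> j t; case: (VE (ltn0Sn j)) => + _ _; exact.
- by move=> j t; rewrite df; exact: ler_dist_dist.
- move=> j t /=; apply: (le_trans (ler_dist_dist _ _)).
  by rewrite reflE addrAC subrr add0r normrN.
- move=> j t /=; have := smX (f j t) (mdiff f j.+1 t).
  by rewrite -reflE df addrCA subrr addr0.
- by move=> j; apply: norm_measurable; exact: f_open_measurable.
- case=> [|j]; first by rewrite /mdiff/=; exact: measurable_cst.
  by apply: norm_diff_measurable => //; exact: f_open_measurable.
- move=> j; apply/(measurable_forP _ (sF j)) => B mB.
  by case: (VE (ltn0Sn j)) => _ mV _; exact: mV.
- move=> j; case: (fint j.+1) => mfj _; case: (fcond j) => mfj' _ _.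
  exact: (reflected_norm_measurable (Fm j) sX mfj' mfj).
- move=> j E FE; case: (fint j.+1) => mfj _; case: (fcond j) => mfj' _ _.
  exact: (reflected_norm_ge (sF j) (Fm j) sX mfj' mfj (@condE j)).
- by move=> j E FE; case: (VE (ltn0Sn j)) => _ _ ->.
Qed.

End martingale_norms.

(** At the origin, [(2, D)]-smoothness reads [`|y| <= D * `|y|]. *)
Lemma smooth2_trivial (R : realType) (X : normedModType R) (D : R) :
  0 < D -> D < 1 -> smooth2 X D -> forall y : X, y = 0.
Proof.
move=> D0 D1 smX y; have := smX 0 y.
rewrite add0r sub0r normrN normr0 expr0n/= mulr0 add0r => h.
apply/eqP; rewrite -normr_eq0 -sqrf_eq0 eq_le sqr_ge0 andbT.
have DD : D ^+ 2 < 1 by rewrite expr_lt1// ltW.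
rewrite leNgt; apply/negP => y0; have : D ^+ 2 * `|y| ^+ 2 < 1 * `|y| ^+ 2.
  by rewrite ltr_pM2r.
lra.
Qed.

Lemma weaken_constants (R : realType) (N Nd Ns : \bar R) (c s A u v : R) :
  (0 <= Nd)%E -> (0 <= Ns)%E -> 0 <= c -> 0 <= s -> 0 <= A -> 0 <= u -> 0 <= v ->
  56 * c <= A * u -> 56 * s <= A * v ->
  (N <= 56%:E * (c%:E * Nd + s%:E * Ns))%E ->
  (N <= A%:E * (u%:E * Nd + v%:E * Ns))%E.
Proof.
move=> Nd0 Ns0 c0 s0 A0 u0 v0 cu sv /le_trans; apply.
rewrite !ge0_muleDr ?mule_ge0 ?lee_fin// !muleA -!EFinM.
by apply: leeD; apply: lee_wpmul2r; rewrite ?lee_fin.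
Qed.

Section choice_of_c.
Context (R : realType) (p : R).
Hypothesis p2 : 2 <= p.

Let p0 : 0 < p. Proof. by apply: lt_le_trans p2. Qed.
Let p1 : 1 <= p. Proof. by apply: le_trans p2; rewrite ler1n. Qed.
Let e2 : 2 <= expR 1 :> R.
Proof. by have := expR_ge1Dx (1 : R); lra. Qed.

Let sqrt_le_self : Num.sqrt p <= p.
Proof.
have s1 : 1 <= Num.sqrt p by rewrite -[leLHS]sqrtr1 ler_wsqrtr.
by rewrite -[leRHS](sqr_sqrtr (ltW p0)) expr2 ler_peMl// sqrtr_ge0.
Qed.

Let ln_le_self : ln p <= p.
Proof.
have h : -1 < p - 1 by move: p0; lra.
by have := le_ln1Dx h; rewrite addrC subrK; lra.
Qed.

Let ln_gt0 : 0 < ln p.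
Proof. by rewrite ln_gt0// (lt_le_trans _ p2)// ltr1n. Qed.

(** Balances the two coefficients at order [p / ln p]: [c = 3 p / ln p] gives
    [expR (p / c) = p `^ (1 / 3)], or [c = p] when [ln p <= 3]. *)
Lemma choice_log : exists2 c : R, 1 <= c <= p &
  c <= 3 * (p / ln p) /\
  Num.sqrt c * expR (p / c) <= 3 * expR 1 * (p / ln p).
Proof.
have [L3|L3] := leP (ln p) 3.
  exists p; rewrite ?p1 ?lexx// divff ?gt_eqF//.
  have pL : p <= 3 * (p / ln p).
    by rewrite mulrCA ler_peMr ?(ltW p0)// ler_pdivlMr// mul1r.
  split=> //; rewrite mulrAC; apply: ler_pM; rewrite ?sqrtr_ge0 ?expR_ge0//.
  exact: le_trans sqrt_le_self pL.
pose c := 3 * (p / ln p).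
have c0 : 0 < c by rewrite mulr_gt0// divr_gt0.
have cE : p / c = ln p / 3 by rewrite /c; field; rewrite !gt_eqF.
pose E := expR (ln p / 3).
have EL : ln p / 3 <= E by have := expR_ge1Dx (ln p / 3); rewrite -/E; lra.
have E0 : 0 < E := expR_gt0 _.
have E3 : E ^+ 3 = p.
  by rewrite -expRM_natl mulrC divfK// lnK// posrE.
have Ec : E <= Num.sqrt c.
  rewrite -[leLHS](gtr0_norm E0) -sqrtr_sqr ler_wsqrtr// /c mulrA ler_pdivlMr//.
  rewrite -[in leRHS]E3; have : E ^+ 2 * (ln p / 3) <= E ^+ 2 * E.
    by rewrite ler_pM2l ?exprn_gt0.
  by rewrite -exprSr; lra.
have c1 : 1 <= c.
  rewrite /c mulrA ler_pdivlMr// mul1r (le_trans ln_le_self)//.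
  by rewrite ler_peMl ?(ltW p0)// ler1n.
have cp : c <= p by rewrite /c mulrA ler_pdivrMr// mulrC ler_pM2l// ltW.
exists c; first by rewrite c1.
split=> //; rewrite cE -/E; apply: (@le_trans _ _ c).
  rewrite -[leRHS](sqr_sqrtr (ltW c0)) expr2.
  by apply: ler_wpM2l; rewrite ?sqrtr_ge0.
have : 0 <= (expR 1 - 1) * (p / ln p).
  by rewrite mulr_ge0 ?divr_ge0 ?(ltW p0) ?(ltW ln_gt0)//; lra.
rewrite /c; lra.
Qed.

(** The condition on [a] says that [expR (p / a)] is at least [expR 1 * p].
    Doubling [a] turns this factor into its square root, which leaves room for
    [Num.sqrt c]; if [2 * a] exceeds [p], then [c = p] does. *)
Lemma choice_power (a : R) : 1 <= a -> a <= p / ln (expR 1 * p) ->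
  exists2 c : R, 1 <= c <= p &
    c <= 2 * a /\ Num.sqrt c * expR (p / c) <= expR (p / a).
Proof.
move=> a1 aL; have a0 : 0 < a := lt_le_trans ltr01 a1.
have ep0 : 0 < expR 1 * p by rewrite mulr_gt0 ?expR_gt0.
have L0 : 0 < ln (expR 1 * p).
  by rewrite lnM ?posrE ?expR_gt0// expRK addr_gt0.
have epB : expR 1 * p <= expR (p / a).
  rewrite -[leLHS]lnK ?posrE// ler_expR ler_pdivlMr// mulrC -ler_pdivlMr//.
have [ap|pa] := leP (2 * a) p; last first.
  exists p; first by rewrite p1 lexx.
  split; first exact: ltW.
  rewrite divff ?gt_eqF// mulrC; apply: le_trans epB.
  by rewrite ler_pM2l ?expR_gt0.
exists (2 * a); first by rewrite ap andbT; lra.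
split=> //; pose E := expR (p / (2 * a)).
have E0 : 0 < E := expR_gt0 _.
have EE : expR (p / a) = E ^+ 2.
  by rewrite -expRM_natl; congr expR; field; rewrite gt_eqF.
rewrite -/E EE expr2 ler_pM2r// -[leRHS](gtr0_norm E0) -sqrtr_sqr ler_wsqrtr//.
rewrite -EE (le_trans ap)// (le_trans _ epB)// ler_peMl ?(ltW p0)//.
by rewrite (le_trans _ e2)// ler1n.
Qed.

End choice_of_c.

Theorem theorem4p1 (R : realType) :
  exists A : R, 0 < A /\
  forall (D : R) (X : completeNormedModType R)
    (d : measure_display) (T : measurableType d) (P : probability T R)
    (F : nat -> set (set T)) (f : nat -> T -> X) (V : nat -> T -> \bar R)
    (p : R),
  0 < D -> smooth2 X D -> separable X ->
  martingale0 P F f -> predictable_squares P F f V ->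
  2 <= p ->
  let Nf := Lnorm P p%:E (maxnorm f) in
  let Nd := Lnorm P p%:E (maxnorm (mdiff f)) in
  let Ns := Lnorm P p%:E (square_function V) in
  [/\ forall c : R, 1 <= c -> c <= p ->
        (Nf <= A%:E * (c%:E * Nd + (Num.sqrt c * expR (p / c) * D)%:E * Ns))%E,
      (Nf <= A%:E * (p%:E * Nd + (Num.sqrt p * D)%:E * Ns))%E,
      (Nf <= (A * (p / ln p))%:E * (Nd + D%:E * Ns))%E &
      forall a : R, 1 <= a -> a <= p / ln (expR 1 * p) ->
        (Nf <= A%:E * (a%:E * Nd + (expR (p / a) * D)%:E * Ns))%E].
Proof.
exists (168 * expR 1); split; first by rewrite mulr_gt0 ?expR_gt0.
move=> D X d T P F f V p D0 smX sX mf VE p2 Nf Nd Ns.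
have Nd0 : (0 <= Nd)%E := Lnorm_ge0 _ _ _.
have Ns0 : (0 <= Ns)%E := Lnorm_ge0 _ _ _.
have p0 : 0 < p by apply: lt_le_trans p2.
have p1 : 1 <= p by apply: le_trans p2; rewrite ler1n.
have key c : 1 <= c -> c <= p ->
    (Nf <= 56%:E * (c%:E * Nd + (Num.sqrt c * expR (p / c) * D)%:E * Ns))%E.
  move=> c1 cp; have [D1|D1] := leP 1 D.
    have np := martingale_norm_process smX sX mf VE.
    exact: (norm_process_Lnorm_le np D1 (fun j t => normr_ge0 _) c1 cp).
  have f0 j t : f j t = 0 by exact: smooth2_trivial smX _.
  have -> : Nf = 0%E.
    rewrite /Nf (_ : maxnorm f = cst 0%E).
      by rewrite Lnorm0// eqe gt_eqF.
    apply/funext => t; rewrite -[RHS]/(0%E) -[RHS]ereal_sup1; congr ereal_sup.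
    apply/seteqP; split=> [_ [j _ <-]|_ ->] /=; first by rewrite f0 normr0.
    by exists 0%N => //; rewrite f0 normr0.
  rewrite mule_ge0// adde_ge0// mule_ge0// lee_fin ?(le_trans _ c1)//.
  by rewrite !mulr_ge0 ?sqrtr_ge0 ?expR_ge0// ltW.
have e2 : 2 <= expR 1 :> R by have := expR_ge1Dx (1 : R); lra.
have A0 : 0 <= 168 * expR 1 :> R by rewrite mulr_ge0 ?expR_ge0.
have s0 (c : R) : 0 <= Num.sqrt c * expR (p / c) * D.
  by rewrite !mulr_ge0 ?sqrtr_ge0 ?expR_ge0// ltW.
split.
- move=> c c1 cp; have c0 : 0 <= c by rewrite (le_trans _ c1).
  apply: weaken_constants (key c c1 cp) => //; apply: ler_wpM2r => //; lra.
- apply: weaken_constants (key p p1 (lexx p)) => //.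
  + exact: ltW.
  + exact: ltW.
  + by rewrite mulr_ge0 ?sqrtr_ge0// ltW.
  + by apply: ler_wpM2r; [exact: ltW|lra].
  rewrite divff ?gt_eqF//.
  have : 0 <= expR 1 * (Num.sqrt p * D).
    by rewrite !mulr_ge0 ?sqrtr_ge0 ?expR_ge0// ltW.
  lra.
- have [c /andP[c1 cp] [cu cv]] := choice_log p2.
  have q0 : 0 <= p / ln p by rewrite divr_ge0 ?(ltW p0)// ln_ge0.
  rewrite EFinM -muleA ge0_muleDr ?mule_ge0 ?lee_fin ?(ltW D0)// muleA -EFinM.
  apply: weaken_constants (key c c1 cp) => //.
  + by rewrite (le_trans _ c1).
  + by rewrite mulr_ge0// ltW.
  + have : 0 <= (expR 1 - 1) * (p / ln p) by rewrite mulr_ge0//; lra.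
    lra.
  move/(ler_wpM2r (ltW D0)): cv; lra.
- move=> a a1 aL; have [c /andP[c1 cp] [cu cv]] := choice_power p2 a1 aL.
  have a0 : 0 <= a by rewrite (le_trans _ a1).
  apply: weaken_constants (key c c1 cp) => //.
  + by rewrite (le_trans _ c1).
  + by rewrite mulr_ge0 ?expR_ge0// ltW.
  + have : 0 <= (expR 1 - 1) * a by rewrite mulr_ge0//; lra.
    lra.
  have B0 : 0 <= expR (p / a) * D by rewrite mulr_ge0 ?expR_ge0// ltW.
  have : 0 <= (expR 1 - 1) * (expR (p / a) * D) by rewrite mulr_ge0//; lra.
  move/(ler_wpM2r (ltW D0)): cv; lra.
Qed.
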